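(* Let $K$ be a field of characteristic zero, $\mathbb{I}_1$ the algebra of polynomial integro-differential operators over $K$, and $A_1$ the first Weyl algebra over $K$. Then: 1. ${}'Q_{l,\mathrm{cl}}(\mathbb{I}_1)\simeq Q(A_1)$ is a division ring and $\mathrm{ass}({}'\mathcal{C}_{\mathbb{I}_1})=F$. 2. $Q'_{r,\mathrm{cl}}(\mathbb{I}_1)\simeq Q(A_1)$ is a division ring and $\mathrm{ass}_r(\mathcal{C}'_{\mathbb{I}_1})=F$.
   Context: $\mathbb{I}_1$ is the subalgebra of $\mathrm{End}_K(K[x])$ generated by (multiplication by) $x$, $\partial=\frac{d}{dx}$ and $\int:K[x]\to K[x]$, $x^m\mapsto\frac{x^{m+1}}{m+1}$ ($m\geq0$); $A_1=K\langle x,\partial\rangle\subset\mathbb{I}_1$ is the first Weyl algebra, a Noetherian domain, and $Q(A_1)$ is its classical (left and right) quotient division ring. $F=\bigoplus_{i,j\geq0}Ke_{ij}$, where $e_{ij}=\int^i\partial^j-\int^{i+1}\partial^{j+1}$; it is the only proper nonzero ideal of $\mathbb{I}_1$. For a ring $R$: ${}'\mathcal{C}_R=\{r\in R\mid xr=0\Rightarrow x=0\}$ (left regular elements) and $\mathcal{C}'_R=\{r\in R\mid rx=0\Rightarrow x=0\}$ (right regular elements). For a nonempty subset $S\subseteq R$, $\mathrm{ass}(S)=\{r\in R\mid sr=0\text{ for some }s\in S\}$ and $\mathrm{ass}_r(S)=\{r\in R\mid rs=0\text{ for some }s\in S\}$. A multiplicative set $S$ ($1\in S$, $SS\subseteq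 S$, $0\notin S$) is a left denominator set if $Sr\cap Rs\neq\emptyset$ for all $r\in R,s\in S$, and $rs=0$ ($s\in S$) implies $r\in\mathrm{ass}(S)$; right denominator sets are defined symmetrically. ${}'Q_{l,\mathrm{cl}}(R):={}'\mathcal{C}_R^{-1}R$ is the left localization at ${}'\mathcal{C}_R$, existing exactly when ${}'\mathcal{C}_R$ is a left denominator set; $Q'_{r,\mathrm{cl}}(R):=R\,{\mathcal{C}'_R}^{-1}$ is the right localization at $\mathcal{C}'_R$, existing exactly when $\mathcal{C}'_R$ is a right denominator set. The statement includes the assertion that these rings exist for $R=\mathbb{I}_1$. *)

(* Defs.v *)
From HB Require Import structures.
From mathcomp Require Import all_boot all_order all_algebra.
From mathcomp Require Import mathcomp_extra boolp classical_sets.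

Set Implicit Arguments.
Unset Strict Implicit.
Unset Printing Implicit Defensive.

Import GRing.Theory.
Local Open Scope classical_set_scope.
Local Open Scope ring_scope.

(* A named copy of the type of linear maps, whose ring product is composition:
   (f * g) p = f (g p). *)
Definition endo (K : fieldType) : Type := {linear {poly K} -> {poly K}}.

HB.instance Definition _ (K : fieldType) := gen_eqMixin (endo K).
HB.instance Definition _ (K : fieldType) := gen_choiceMixin (endo K).

Section EndoAlgebra.
Variable K : fieldType.
Implicit Types f g h : endo K.

Lemma endoP f g : (f : {poly K} -> {poly K}) =1 g -> f = g.
Proof.
case: f g => [f cf] [g cg] /= /funext fg; subst g.
case: cf cg => [[f1] [f2]] [[g1] [g2]].
by rewrite (Prop_irrelevance f1 g1) (Prop_irrelevance f2 g2).
Qed.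

Definition endo_zero : endo K := \0.
Definition endo_opp f : endo K := \- f.
Definition endo_add f g : endo K := f \+ g.
Definition endo_one : endo K := idfun.
Definition endo_mul f g : endo K := f \o g.
Definition endo_scale (c : K) f : endo K := c \*: f.

Let addA : associative endo_add.
Proof. by move=> f g h; apply: endoP => p /=; rewrite addrA. Qed.
Let addC : commutative endo_add.
Proof. by move=> f g; apply: endoP => p /=; rewrite addrC. Qed.
Let add0 : left_id endo_zero endo_add.
Proof. by move=> f; apply: endoP => p /=; rewrite add0r. Qed.
Let addN : left_inverse endo_zero endo_opp endo_add.
Proof. by move=> f; apply: endoP => p /=; rewrite addNr. Qed.

HB.instance Definition _ := GRing.isZmodule.Build (endo K) addA addC add0 addN.

Let mulA : associative endo_mul.
Proof. by move=> f g h; apply: endoP. Qed.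
Let mul1 : left_id endo_one endo_mul.
Proof. by move=> f; apply: endoP. Qed.
Let mulr1 : right_id endo_one endo_mul.
Proof. by move=> f; apply: endoP. Qed.
Let mulDl : left_distributive endo_mul endo_add.
Proof. by move=> f g h; apply: endoP. Qed.
Let mulDr : right_distributive endo_mul endo_add.
Proof. by move=> f g h; apply: endoP => p; rewrite /= raddfD. Qed.
Let one_neq0 : endo_one != endo_zero.
Proof.
apply/eqP => /(congr1 (fun f : endo K => f 1)) /= /eqP.
by rewrite oner_eq0.
Qed.

HB.instance Definition _ :=
  GRing.Zmodule_isNzRing.Build (endo K) mulA mul1 mulr1 mulDl mulDr one_neq0.

Let scaleA (a b : K) f : endo_scale a (endo_scale b f) = endo_scale (a * b) f.
Proof. by apply: endoP => p /=; rewrite scalerA. Qed.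
Let scale1 : left_id 1 endo_scale.
Proof. by move=> f; apply: endoP => p /=; rewrite scale1r. Qed.
Let scaleDr : right_distributive endo_scale +%R.
Proof. by move=> a f g; apply: endoP => p /=; rewrite scalerDr. Qed.
Let scaleDl f : {morph endo_scale^~ f : a b / a + b}.
Proof. by move=> a b; apply: endoP => p /=; rewrite scalerDl. Qed.

HB.instance Definition _ :=
  GRing.Zmodule_isLmodule.Build K (endo K) scaleA scale1 scaleDr scaleDl.

Let scaleAl (a : K) f g : a *: (f * g) = (a *: f) * g.
Proof. by apply: endoP. Qed.
HB.instance Definition _ := GRing.Lmodule_isLalgebra.Build K (endo K) scaleAl.
Let scaleAr (a : K) f g : a *: (f * g) = f * (a *: g).
Proof. by apply: endoP => p; rewrite /= linearZ. Qed.
HB.instance Definition _ := GRing.Lalgebra_isAlgebra.Build K (endo K) scaleAr.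

End EndoAlgebra.

Section GeneratedSubalgebra.
Variables (K : fieldType) (A : algType K) (G : set A).

Definition gen_pred : {pred A} := fun a =>
  `[< forall S : {pred A}, GRing.subalg_closed S ->
        (forall g, G g -> g \in S) -> a \in S >].

Lemma gen_subalg_closed : GRing.subalg_closed gen_pred.
Proof.
split.
- by apply/asboolP => S [].
- move=> c u v /asboolP Gu /asboolP Gv; apply/asboolP => S clS GS.
  by case: (clS) => _ SZ _; apply: SZ; [apply: Gu|apply: Gv].
- move=> u v /asboolP Gu /asboolP Gv; apply/asboolP => S clS GS.
  by case: (clS) => _ _ SM; apply: SM; [apply: Gu|apply: Gv].
Qed.

Lemma mem_gen g : G g -> g \in gen_pred.
Proof. by move=> Gg; apply/asboolP => S _; apply. Qed.

Record gen_subalg : Type :=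
  GenSubalg { gen_val : A; _ : gen_val \in gen_pred }.

HB.instance Definition _ := [isSub for gen_val].
HB.instance Definition _ := [Choice of gen_subalg by <:].
HB.instance Definition _ := GRing.SubChoice_isSubAlgebra.Build K A gen_pred
  gen_subalg (GRing.subalg_closed_semi gen_subalg_closed).

End GeneratedSubalgebra.

Section IntegroDifferential.
Variable K : fieldType.

Definition mulX_fun (p : {poly K}) : {poly K} := 'X * p.

Lemma mulX_fun_is_linear : linear mulX_fun.
Proof. by move=> c p q; rewrite /mulX_fun mulrDr scalerAr. Qed.
HB.instance Definition _ :=
  GRing.isLinear.Build K {poly K} {poly K} *:%R mulX_fun mulX_fun_is_linear.

Definition integ_fun (p : {poly K}) : {poly K} :=
  \sum_(i < size p) (p`_i / i.+1%:R) *: 'X^(i.+1).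

Lemma coef_integ_fun p i :
  (integ_fun p)`_i = if i is j.+1 then p`_j / j.+1%:R else 0.
Proof.
rewrite /integ_fun coef_sum; case: i => [|j].
  by rewrite big1 // => k _; rewrite coefZ coefXn mulr0.
have [jp|pj] := ltnP j (size p).
  rewrite (bigD1 (Ordinal jp)) //= coefZ coefXn eqxx mulr1 big1 ?addr0 // => k.
  by rewrite -val_eqE /= coefZ coefXn eqSS eq_sym => /negbTE->; rewrite mulr0.
rewrite (nth_default _ pj) mul0r big1 // => k _.
by rewrite coefZ coefXn eqSS gtn_eqF ?mulr0 // (leq_trans (ltn_ord k) pj).
Qed.

Lemma integ_fun_is_linear : linear integ_fun.
Proof.
move=> c p q; apply/polyP => -[|i]; rewrite coefD coefZ !coef_integ_fun.
  by rewrite mulr0 addr0.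
by rewrite coefD coefZ mulrDl mulrA.
Qed.
HB.instance Definition _ :=
  GRing.isLinear.Build K {poly K} {poly K} *:%R integ_fun integ_fun_is_linear.

Lemma integ_funXn m : integ_fun 'X^m = (m.+1%:R)^-1 *: 'X^(m.+1).
Proof.
apply/polyP => -[|i]; rewrite coef_integ_fun coefZ !coefXn ?mulr0 // eqSS.
by case: eqVneq => [->|_]; rewrite ?mulr0 ?mul0r // mulrC.
Qed.

Definition mulX : endo K := mulX_fun.
Definition diff : endo K := @deriv K.
Definition integ : endo K := integ_fun.

(* The first Weyl algebra; in characteristic zero it is the subalgebra
   K<x, d/dx> of End_K(K[x]). *)
Definition A1 : algType K := gen_subalg [set mulX; diff].

Definition I1_gens : set (endo K) := [set mulX; diff; integ].
Definition I1 : algType K := gen_subalg I1_gens.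

Lemma diff_I1 : I1_gens diff. Proof. by left; right. Qed.
Lemma integ_I1 : I1_gens integ. Proof. by right. Qed.

Definition I1_diff : I1 := GenSubalg (mem_gen diff_I1).
Definition I1_integ : I1 := GenSubalg (mem_gen integ_I1).

Definition e_ (i j : nat) : I1 :=
  I1_integ ^+ i * I1_diff ^+ j - I1_integ ^+ i.+1 * I1_diff ^+ j.+1.

Definition F_ideal : set I1 := [set r | exists (n : nat) (c : 'M[K]_n),
  r = \sum_(i < n) \sum_(j < n) c i j *: e_ i j].

End IntegroDifferential.

Arguments F_ideal : clear implicits.

Section Localization.
Variable R : nzRingType.
Implicit Type S : set R.

Definition left_regular : set R := [set r | forall x, x * r = 0 -> x = 0].
Definition right_regular : set R := [set r | forall x, r * x = 0 -> x = 0].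
Definition regular_elements : set R := left_regular `&` right_regular.

Definition ass_l S : set R := [set r | exists2 s, S s & s * r = 0].
Definition ass_r S : set R := [set r | exists2 s, S s & r * s = 0].

Definition multiplicative_set S : Prop :=
  [/\ S 1, forall s t, S s -> S t -> S (s * t) & ~ S 0].

Definition left_denominator_set S : Prop :=
  [/\ multiplicative_set S,
      forall r s, S s -> exists t a, S t /\ t * r = a * s &
      forall r s, S s -> r * s = 0 -> ass_l S r].

Definition right_denominator_set S : Prop :=
  [/\ multiplicative_set S,
      forall r s, S s -> exists t a, S t /\ r * t = s * a &
      forall r s, S s -> s * r = 0 -> ass_r S r].

(* f : R -> Q exhibits Q as S^-1 R *)
Definition left_localization S (Q : unitRingType) (f : {rmorphism R -> Q}) :=
  [/\ forall s, S s -> f s \is a GRing.unit,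
      forall q, exists s r, S s /\ q = (f s)^-1 * f r &
      [set r | f r = 0] = ass_l S].

(* f : R -> Q exhibits Q as R S^-1 *)
Definition right_localization S (Q : unitRingType) (f : {rmorphism R -> Q}) :=
  [/\ forall s, S s -> f s \is a GRing.unit,
      forall q, exists s r, S s /\ q = f r * (f s)^-1 &
      [set r | f r = 0] = ass_r S].

(* f : R -> Q exhibits Q as the two-sided classical quotient ring Q(R) *)
Definition classical_quotient_ring (Q : unitRingType) (f : {rmorphism R -> Q}) :=
  left_localization regular_elements f /\ right_localization regular_elements f.

End Localization.

Arguments left_regular : clear implicits.
Arguments right_regular : clear implicits.
Arguments regular_elements : clear implicits.

Definition division_ring (D : unitRingType) : Prop :=
  forall x : D, x != 0 -> x \is a GRing.unit.

(* Q and D, seen as K-algebras through f : A -> Q and g : B -> D, are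
   isomorphic K-algebras. *)
Definition isomorphic_over (K : fieldType) (A B : algType K)
    (Q D : unitRingType) (f : {rmorphism A -> Q}) (g : {rmorphism B -> D}) :=
  exists2 phi : {rmorphism Q -> D},
    bijective phi & forall c : K, phi (f c%:A) = g c%:A.

(* Main.v *)
From HB Require Import structures.
Require Import Defs.
From mathcomp Require Import all_boot all_order all_algebra.
From mathcomp Require Import zify.
From mathcomp Require Import mathcomp_extra boolp classical_sets.

Set Implicit Arguments.
Unset Strict Implicit.
Unset Printing Implicit Defensive.

Import GRing.Theory.
Local Open Scope ring_scope.

(** Put $D = \partial$, $J = \int$ and $H = \partial x$. The algebra $I_1$ is
    generated by [D], [J], [H], where $DJ = 1$, $H = JHD + 1$ and $JD \ne 1$.
    This presentation is self-dual: it is preserved when the product is reversed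
    and [D] and [J] are exchanged. The properties of $I_1$ are therefore proved for an
    arbitrary algebra with such a triple, and each one-sided statement yields its
    mirror image in the converse algebra; this is how the second half of the
    theorem follows from the arguments for the first half.

    Let [W] be the set of the sums $\sum_j p_j(H) D^j$, a skew polynomial ring
    which is a domain ([ev_mul_eq0]). Left multiplication by a high power of
    [D] sends any given element into [W] ([skew_eval_cofinal]), and the elements
    killed by a power of [D] are exactly those of [F] ([torsion_matrix]); hence
    [F] is a completely prime ideal. A left regular element is not in [F], since
    powers of [D] do not vanish. Conversely, if [s] is not in [F] then $D^N s$ is
    left regular for some [N] ([left_regular_multiple]): the leading coefficient
    $p_n$ of an element of [W] has finitely many natural roots, and multiplying
    by $D^N$ moves all the arguments at which it matters beyond them. So
    inverting the left regular elements, or the right regular ones, amounts to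
    inverting everything outside [F], and the result is a division ring.

    The Ore conditions come from [W], where they hold because the dimension of
    the filtration grows quadratically ([skew_relation]). Since [W] is contained
    in $A_1$ and $A_1$ meets [F] only in 0, the same localization restricted to
    $A_1$ is its quotient ring ([A1_classical_quotient_ring]). Existence of the
    localization is Ore's theorem ([left_localization_exists]), and the
    isomorphisms come from its universal property ([left_localization_unique]). *)

(** * Existence of Ore localizations *)

Section OreLocalization.
Variables (R : nzRingType) (S : set R).
Hypothesis denS : left_denominator_set S.

Let tor := ass_l S.

Let S1 : S 1. Proof. by case: denS => -[]. Qed.
Let SM s t : S s -> S t -> S (s * t).
Proof. by case: denS => -[_ H _] _ _; apply: H. Qed.
Let ore r s : S s -> exists t a, S t /\ t * r = a * s.
Proof. by case: denS => _ H _; apply: H. Qed.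

Lemma tor0 : tor 0. Proof. by exists 1; rewrite ?mulr0. Qed.

Lemma torD x y : tor x -> tor y -> tor (x + y).
Proof.
move=> [s Ss sx0] [t St ty0]; have [t' [a [St' e]]] := ore s St.
exists (t' * s); first exact: SM.
by rewrite mulrDr -mulrA sx0 mulr0 add0r e -mulrA ty0 mulr0.
Qed.

Lemma torN x : tor x -> tor (- x).
Proof. by move=> [s Ss sx0]; exists s; rewrite // mulrN sx0 oppr0. Qed.

Lemma tor_mull r x : tor x -> tor (r * x).
Proof.
move=> [s Ss sx0]; have [t [a [St e]]] := ore r Ss.
by exists t; rewrite // mulrA e -mulrA sx0 mulr0.
Qed.

Lemma tor_mulr r x : tor x -> tor (x * r).
Proof. by move=> [s Ss sx0]; exists s; rewrite // mulrA sx0 mul0r. Qed.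

Lemma tor_cancell s x : S s -> tor (s * x) -> tor x.
Proof. by move=> Ss [t St e]; exists (t * s); [apply: SM | rewrite -mulrA]. Qed.

Lemma tor_cancelr s x : S s -> tor (x * s) -> tor x.
Proof.
move=> Ss [t St]; rewrite mulrA => e; apply: (tor_cancell St).
by case: denS => _ _ H; apply: H e.
Qed.

Lemma torB_trans y x z : tor (x - y) -> tor (y - z) -> tor (x - z).
Proof. by move=> /torD h /h; rewrite addrA subrK. Qed.

Lemma torB_sym x y : tor (x - y) -> tor (y - x).
Proof. by move=> /torN; rewrite opprB. Qed.

Lemma torB_refl x : tor (x - x).
Proof. by rewrite subrr; apply: tor0. Qed.

(** Up to torsion, [phi] acts on the left ideal generated by [s] as right
    multiplication by the fraction $s^{-1}r$. *)
Definition represents (phi : R -> R) s r :=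
  forall x y, tor (y - x * s) -> tor (phi y - x * r).

Lemma represents_mul phi t s r :
  represents phi s r -> represents phi (t * s) (t * r).
Proof. by move=> h x y; rewrite !mulrA => /h. Qed.
Arguments represents_mul [phi] t [s r].

Lemma represents_tor phi s r r' :
  represents phi s r -> tor (r - r') -> represents phi s r'.
Proof.
move=> h e x y /h /torB_trans; apply.
by rewrite -mulrBr; apply: tor_mull.
Qed.

Lemma represents_uniq phi s r r' :
  represents phi s r -> represents phi s r' -> tor (r - r').
Proof.
move=> h h'; have e : tor (s - 1 * s) by rewrite mul1r; apply: torB_refl.
have := h' _ _ e; have := h _ _ e; rewrite !mul1r => /torB_sym.
exact: torB_trans.
Qed.

(** The left ideals generated by denominators form a filter basis, which is what
    lets two partial maps be compared or added. *)
Lemma common_denominator s s' : S s -> S s' ->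
  exists t a, S (t * s) /\ t * s = a * s'.
Proof.
move=> Ss Ss'; have [t [a [St e]]] := ore s Ss'.
by exists t, a; split => //; apply: SM.
Qed.

Lemma represents_comp phi psi s r s' r' t a :
  represents phi s r -> represents psi s' r' -> t * r = a * s' ->
  represents (psi \o phi) (t * s) (a * r').
Proof.
by move=> h h' e x y /(represents_mul t h); rewrite e mulrA => /h'; rewrite mulrA.
Qed.

Lemma represents_add phi psi s r r' :
  represents phi s r -> represents psi s r' ->
  represents (fun x => phi x + psi x) s (r + r').
Proof.
move=> h h' x y e; rewrite mulrDr opprD addrACA.
by apply: torD; [apply: h | apply: h'].
Qed.

Lemma represents_opp phi s r :
  represents phi s r -> represents (fun x => - phi x) s (- r).
Proof. by move=> h x y e; rewrite mulrN -opprD; apply/torN/h. Qed.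

Lemma represents_mulr r : represents (fun x => x * r) 1 r.
Proof. by move=> x y; rewrite mulr1 -mulrBl => /(tor_mulr r). Qed.

Lemma represents_cst0 : represents (fun=> 0) 1 0.
Proof. by move=> x y _; rewrite mulr0; apply: torB_refl. Qed.

Lemma represents_id : represents id 1 1.
Proof. by move=> x y; rewrite !mulr1. Qed.

(** An element $s^{-1}r$ of the localization is encoded by the right
    multiplication map that it induces on the left ideal generated by [s];
    total functions, arbitrary away from that ideal, stand for partial maps.
    Composition of maps is the product of fractions, so associativity and most
    ring axioms hold on the nose. *)
Record germ := Germ {
  germ_fun :> R -> R;
  germP : exists s r, S s /\ represents germ_fun s r }.

HB.instance Definition _ := gen_eqMixin germ.
HB.instance Definition _ := gen_choiceMixin germ.

Definition same_germ (phi psi : germ) : bool :=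
  `[< exists s r, [/\ S s, represents phi s r & represents psi s r] >].

Lemma same_germ_refl : reflexive same_germ.
Proof.
by move=> phi; apply/asboolP; have [s [r [Ss h]]] := germP phi; exists s, r.
Qed.

Lemma same_germ_sym : symmetric same_germ.
Proof.
by move=> phi psi; apply/asboolP/asboolP => -[s [r [Ss h h']]]; exists s, r.
Qed.

Lemma same_germ_trans : transitive same_germ.
Proof.
move=> psi phi chi /asboolP [s [r [Ss h1 h2]]] /asboolP [s' [r' [Ss' h3 h4]]].
apply/asboolP; have [t [a [Sts e]]] := common_denominator Ss Ss'.
exists (t * s), (t * r); split => //; first exact: represents_mul.
have h5 := represents_mul a h3; rewrite -e in h5.
have h6 := represents_mul a h4; rewrite -e in h6.
apply: (represents_tor h6).
exact: represents_uniq h5 (represents_mul t h2).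
Qed.

Canonical same_germ_equiv :=
  EquivRel same_germ same_germ_refl same_germ_sym same_germ_trans.

Definition ore_ring := {eq_quot same_germ_equiv}%qT.
HB.instance Definition _ := Choice.on ore_ring.

Definition class (phi : germ) : ore_ring := (\pi phi)%qT.

Lemma class_eqP (phi psi : germ) :
  (exists s r, [/\ S s, represents phi s r & represents psi s r]) <->
  class phi = class psi.
Proof. by rewrite /class; split => [h|/eqmodP /asboolP //]; apply/eqmodP/asboolP. Qed.

Lemma class_surj (q : ore_ring) : exists phi, class phi = q.
Proof. by exists (repr q); apply: reprK. Qed.

Lemma eq_class (phi psi : germ) : phi =1 psi -> class phi = class psi.
Proof.
move=> e; apply/class_eqP; have [s [r [Ss h]]] := germP phi.
by exists s, r; split => // x y; rewrite -e; apply: h.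
Qed.

Lemma common_fractions (phi psi : germ) : exists u r r',
  [/\ S u, represents phi u r & represents psi u r'].
Proof.
have [s [r [Ss h]]] := germP phi; have [s' [r' [Ss' h']]] := germP psi.
have [t [a [Sts e]]] := common_denominator Ss Ss'.
exists (t * s), (t * r), (a * r'); split => //; first exact: represents_mul.
by rewrite e; apply: represents_mul.
Qed.

Lemma germ_add_proof (phi psi : germ) :
  exists s r, S s /\ represents (fun x => phi x + psi x) s r.
Proof.
have [u [r [r' [Su h h']]]] := common_fractions phi psi.
by exists u, (r + r'); split => //; apply: represents_add.
Qed.
Definition germ_add phi psi := Germ (germ_add_proof phi psi).

Lemma germ_mul_proof (phi psi : germ) :
  exists s r, S s /\ represents (psi \o phi) s r.
Proof.
have [s [r [Ss h]]] := germP phi; have [s' [r' [Ss' h']]] := germP psi.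
have [t [a [St e]]] := ore r Ss'.
exists (t * s), (a * r'); split; first exact: SM.
exact: represents_comp e.
Qed.
(** Fractions act by right multiplication, so the left factor is applied first. *)
Definition germ_mul phi psi := Germ (germ_mul_proof phi psi).

Lemma germ_opp_proof (phi : germ) :
  exists s r, S s /\ represents (fun x => - phi x) s r.
Proof.
have [s [r [Ss h]]] := germP phi.
by exists s, (- r); split => //; apply: represents_opp.
Qed.
Definition germ_opp phi := Germ (germ_opp_proof phi).

Definition germ_mulr r : germ :=
  Germ (ex_intro _ 1 (ex_intro _ r (conj S1 (represents_mulr r)))).
Definition germ_zero : germ :=
  Germ (ex_intro _ 1 (ex_intro _ 0 (conj S1 represents_cst0))).
Definition germ_one : germ :=
  Germ (ex_intro _ 1 (ex_intro _ 1 (conj S1 represents_id))).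

Definition ore_add (p q : ore_ring) := class (germ_add (repr p) (repr q)).
Definition ore_mul (p q : ore_ring) := class (germ_mul (repr p) (repr q)).
Definition ore_opp (p : ore_ring) := class (germ_opp (repr p)).

Lemma class_repr (phi : germ) :
  exists s r, [/\ S s, represents (repr (class phi)) s r & represents phi s r].
Proof. by apply/class_eqP; apply: reprK. Qed.

Lemma class_add phi psi :
  class (germ_add phi psi) = ore_add (class phi) (class psi).
Proof.
apply/esym/class_eqP.
have [s [r [Ss h1 h2]]] := class_repr phi.
have [s' [r' [Ss' h3 h4]]] := class_repr psi.
have [t [a [Sts e]]] := common_denominator Ss Ss'.
exists (t * s), (t * r + a * r'); split => //; apply: represents_add;
  by [apply: represents_mul | rewrite e; apply: represents_mul].
Qed.

Lemma class_mul phi psi :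
  class (germ_mul phi psi) = ore_mul (class phi) (class psi).
Proof.
apply/esym/class_eqP.
have [s [r [Ss h1 h2]]] := class_repr phi.
have [s' [r' [Ss' h3 h4]]] := class_repr psi.
have [t [a [St e]]] := ore r Ss'.
by exists (t * s), (a * r'); split;
  [apply: SM | apply: represents_comp e | apply: represents_comp e].
Qed.

Lemma class_opp phi : class (germ_opp phi) = ore_opp (class phi).
Proof.
apply/esym/class_eqP; have [s [r [Ss h1 h2]]] := class_repr phi.
by exists s, (- r); split => //; apply: represents_opp.
Qed.

Lemma ore_addA : associative ore_add.
Proof.
move=> p q r; have [x <-] := class_surj p; have [y <-] := class_surj q.
have [z <-] := class_surj r.
by rewrite -!class_add; apply: eq_class => t /=; rewrite addrA.
Qed.

Lemma ore_addC : commutative ore_add.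
Proof.
move=> p q; have [x <-] := class_surj p; have [y <-] := class_surj q.
by rewrite -!class_add; apply: eq_class => t /=; rewrite addrC.
Qed.

Lemma ore_add0 : left_id (class germ_zero) ore_add.
Proof.
move=> p; have [x <-] := class_surj p.
by rewrite -!class_add; apply: eq_class => t /=; rewrite add0r.
Qed.

Lemma ore_addN : left_inverse (class germ_zero) ore_opp ore_add.
Proof.
move=> p; have [x <-] := class_surj p.
by rewrite -class_opp -!class_add; apply: eq_class => t /=; rewrite addNr.
Qed.

HB.instance Definition _ :=
  GRing.isZmodule.Build ore_ring ore_addA ore_addC ore_add0 ore_addN.

Lemma ore_mulA : associative ore_mul.
Proof.
move=> p q r; have [x <-] := class_surj p; have [y <-] := class_surj q.
have [z <-] := class_surj r.
by rewrite -!class_mul; apply: eq_class => t.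
Qed.

Lemma ore_mul1 : left_id (class germ_one) ore_mul.
Proof.
move=> p; have [x <-] := class_surj p.
by rewrite -!class_mul; apply: eq_class => t.
Qed.

Lemma ore_mulr1 : right_id (class germ_one) ore_mul.
Proof.
move=> p; have [x <-] := class_surj p.
by rewrite -!class_mul; apply: eq_class => t.
Qed.

Lemma ore_mulDl : left_distributive ore_mul ore_add.
Proof.
move=> p q r; have [x <-] := class_surj p; have [y <-] := class_surj q.
have [z <-] := class_surj r.
rewrite -(class_add x y) -!class_mul -class_add; apply/class_eqP.
have [u [b [b' [Su hx hy]]]] := common_fractions x y.
have [s [c [Ss hz]]] := germP z.
(* a single left factor clears the denominator s in both numerators *)
have [t1 [a1 [St1 e1]]] := ore b Ss.
have [t2 [a2 [St2 e2]]] := ore (t1 * b') Ss.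
have ex : (t2 * t1) * b = (t2 * a1) * s by rewrite -!mulrA e1.
have ey : (t2 * t1) * b' = a2 * s by rewrite -mulrA.
exists ((t2 * t1) * u), ((t2 * a1) * c + a2 * c); split.
- by apply: SM => //; apply: SM.
- rewrite -mulrDl.
  apply: represents_comp (represents_add hx hy) hz _.
  by rewrite mulrDr ex ey mulrDl.
- by apply: represents_add; [apply: represents_comp hz ex|apply: represents_comp hz ey].
Qed.

Lemma ore_mulDr : right_distributive ore_mul ore_add.
Proof.
move=> p q r; have [x <-] := class_surj p; have [y <-] := class_surj q.
have [z <-] := class_surj r.
by rewrite -(class_add y z) -!class_mul -class_add; apply: eq_class => t.
Qed.

Lemma class_mulr_eq0 r : class (germ_mulr r) = class germ_zero <-> tor r.
Proof.
split=> [/class_eqP [s [b [Ss h1 h2]]]|tr].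
  have es : tor (s - 1 * s) by rewrite mul1r; apply: torB_refl.
  apply: (tor_cancell Ss); have := torB_trans (h1 _ _ es) (torB_sym (h2 _ _ es)).
  by rewrite subr0.
apply/class_eqP; exists 1, 0; split => // [x y _|]; last exact: represents_cst0.
by rewrite mulr0 subr0; apply: tor_mull.
Qed.

Lemma class_mulr1 : class (germ_mulr 1) = class germ_one.
Proof. by apply: eq_class => x /=; rewrite mulr1. Qed.

Lemma ore_one_neq0 : class germ_one != 0.
Proof.
apply/eqP; rewrite -class_mulr1 => /class_mulr_eq0 [s Ss].
by rewrite mulr1 => s0; case: denS => -[_ _ []]; rewrite -s0.
Qed.

HB.instance Definition _ := GRing.Zmodule_isNzRing.Build ore_ring
  ore_mulA ore_mul1 ore_mulr1 ore_mulDl ore_mulDr ore_one_neq0.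

Definition ore_unit : {pred ore_ring} :=
  fun p => `[< exists q, q * p = 1 /\ p * q = 1 >].

Definition ore_inv (p : ore_ring) : ore_ring :=
  if pselect (exists q, q * p = 1 /\ p * q = 1) is left h
  then projT1 (cid h) else p.

Lemma ore_invP p : p \in ore_unit -> ore_inv p * p = 1 /\ p * ore_inv p = 1.
Proof.
by move=> /asboolP h; rewrite /ore_inv; case: pselect => // h'; case: cid.
Qed.

Lemma ore_mulVr : {in ore_unit, left_inverse 1 ore_inv *%R}.
Proof. by move=> p /ore_invP []. Qed.
Lemma ore_divrr : {in ore_unit, right_inverse 1 ore_inv *%R}.
Proof. by move=> p /ore_invP []. Qed.
Lemma ore_unitP (p q : ore_ring) : q * p = 1 /\ p * q = 1 -> ore_unit p.
Proof. by move=> h; apply/asboolP; exists q. Qed.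
Lemma ore_inv_out : {in [predC ore_unit], ore_inv =1 id}.
Proof.
move=> p; rewrite inE => /asboolP h; rewrite /ore_inv.
by case: pselect.
Qed.

HB.instance Definition _ := GRing.NzRing_hasMulInverse.Build ore_ring
  ore_mulVr ore_divrr ore_unitP ore_inv_out.

Definition ore_map (r : R) : ore_ring := class (germ_mulr r).

Lemma ore_map_is_zmod : zmod_morphism ore_map.
Proof.
move=> x y; rewrite /ore_map -[RHS]/(ore_add _ (ore_opp _)) -class_opp -class_add.
by apply: eq_class => t /=; rewrite mulrBr.
Qed.
HB.instance Definition _ := GRing.isZmodMorphism.Build R ore_ring ore_map ore_map_is_zmod.

Lemma ore_map_is_monoid : monoid_morphism ore_map.
Proof.
split=> [|x y]; first exact: class_mulr1.
rewrite /ore_map -[RHS]/(ore_mul _ _) -class_mul.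
by apply: eq_class => t /=; rewrite mulrA.
Qed.
HB.instance Definition _ := GRing.isMonoidMorphism.Build R ore_ring ore_map ore_map_is_monoid.

(** The partial map that inverts right multiplication by [s]; its values are
    determined up to torsion. *)
Definition divide s y := xget 0 [set x | tor (y - x * s)].

Lemma represents_divide s : S s -> represents (divide s) s 1.
Proof.
move=> Ss x y h; rewrite mulr1 /divide; case: xgetP => [z _ hz|]; last first.
  by move=> /(_ x) /=.
apply: (tor_cancelr Ss); rewrite mulrBl.
exact: torB_trans (torB_sym hz) h.
Qed.

Definition germ_divide s (Ss : S s) : germ :=
  Germ (ex_intro _ s (ex_intro _ 1 (conj Ss (represents_divide Ss)))).

Lemma ore_map_unit s : S s -> ore_map s \is a GRing.unit.
Proof.
move=> Ss; apply/asboolP; exists (class (germ_divide Ss)).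
rewrite /ore_map -![_ * _]/(ore_mul _ _) -!class_mul; split; apply/class_eqP.
- exists s, s; split => //.
  have := represents_comp (represents_divide Ss) (represents_mulr s)
    (erefl (1 * 1)).
  by rewrite !mul1r.
- exists 1, 1; split => //.
  have /= := represents_comp (represents_mulr s) (represents_divide Ss)
    (erefl (1 * s)).
  by rewrite !mul1r.
Qed.

Lemma ore_left_localization : left_localization S ore_map.
Proof.
split; first exact: ore_map_unit.
- move=> q; have [phi <-] := class_surj q; have [s [r [Ss h]]] := germP phi.
  exists s, r; split=> //; apply: (canRL (mulKr (ore_map_unit Ss))).
  rewrite /ore_map -[LHS]/(ore_mul _ _) -class_mul; apply/class_eqP.
  exists 1, r; split=> //; last exact: represents_mulr.
  have := represents_comp (represents_mulr s) h (erefl (1 * s)).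
  by rewrite !mul1r.
- apply/seteqP; split => r h; last by apply/class_mulr_eq0.
  by apply: (proj1 (class_mulr_eq0 r)).
Qed.

End OreLocalization.

(** Ore's theorem: $S^{-1}R$ is the ring of germs of partial right multiplication
    maps, two maps being identified when they agree up to torsion on the left
    ideal generated by some element of [S]. *)
Lemma left_localization_exists (R : nzRingType) (S : set R) :
  left_denominator_set S ->
  exists (Q : unitRingType) (f : {rmorphism R -> Q}), left_localization S f.
Proof. by move=> denS; exists (ore_ring denS), (ore_map denS); apply: ore_left_localization. Qed.
(** * Linear dependence and roots in characteristic zero *)

(** A homogeneous linear system with more unknowns than equations has a
    nontrivial solution. *)
Lemma span_dependent (K : fieldType) (V : lmodType K) (I J : finType)
    (v : I -> V) (b : J -> V) (A : I -> J -> K) :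
  (forall i, v i = \sum_j A i j *: b j) -> (#|J| < #|I|)%N ->
  exists c : I -> K, (exists i, c i != 0) /\ \sum_i c i *: v i = 0.
Proof.
move=> vE ltJI.
pose M : 'M[K]_(#|I|, #|J|) := \matrix_(i, j) A (enum_val i) (enum_val j).
have : kermx M != 0.
  rewrite kermx_eq0 /row_free neq_ltn.
  by rewrite (leq_ltn_trans (rank_leq_col M) ltJI).
case/matrix0Pn => k [l kl0]; pose c i : K := kermx M k (enum_rank i).
exists c; split; first by exists (enum_val l); rewrite /c enum_valK.
have eq0 j : \sum_i c i * A i j = 0.
  transitivity ((kermx M *m M) k (enum_rank j)); last by rewrite mulmx_ker mxE.
  rewrite mxE (reindex _ (onW_bij _ (enum_rank_bij I))) /=.
  by apply: eq_bigr => i _; rewrite /c !mxE !enum_rankK.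
under eq_bigr do rewrite vE scaler_sumr.
rewrite exchange_big big1 //= => j _.
under eq_bigr do rewrite scalerA.
by rewrite -scaler_suml eq0 scale0r.
Qed.

(** The natural numbers embed in [K], so only finitely many are roots of [p]. *)
Lemma nat_root_bound (K : fieldType) (p : {poly K}) :
  [pchar K] =i pred0 -> p != 0 ->
  exists N, forall k, (N <= k)%N -> p.[k%:R] != 0.
Proof.
move=> charK; have [n] := ubnP (size p); elim: n p => // n IH p lepn p0.
have [[k /factor_theorem [q pE]]|nroot] := pselect (exists k : nat, root p k%:R); last first.
  by exists 0 => k _; apply/negP => pk; apply: nroot; exists k.
have q0 : q != 0 by apply: contraNneq p0 => q0; rewrite pE q0 mul0r.
have ltq : (size q < n)%N.
  by move: lepn; rewrite pE size_Mmonic ?monicXsubC // size_XsubC addn2.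
have [N Nq] := IH q ltq q0; exists (maxn N k.+1) => m; rewrite geq_max => /andP [Nm km].
rewrite pE hornerM hornerXsubC mulf_neq0 ?Nq // -natrB ?(ltnW km) //.
by rewrite (proj1 (pcharf0P K) charK) subn_eq0 -ltnNge.
Qed.

(** * The converse algebra *)

(** The scalars of [R] are central, so they also act on the converse ring and make
    it an algebra. *)
Section ConverseAlgebra.
Variables (K : fieldType) (R : algType K).

HB.instance Definition _ := GRing.Zmodule_isLmodule.Build K R^c
  (@scalerA _ R) (@scale1r _ R) (@scalerDr _ R) (@scalerDl _ R).

Fact converse_scalerAl (a : K) (u v : R^c) : a *: (u * v) = (a *: u) * v.
Proof. exact: (@scalerAr _ R). Qed.
HB.instance Definition _ := GRing.Lmodule_isLalgebra.Build K R^c converse_scalerAl.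

Fact converse_scalerAr (a : K) (u v : R^c) : a *: (u * v) = u * (a *: v).
Proof. exact: (@scalerAl _ R). Qed.
HB.instance Definition _ := GRing.Lalgebra_isAlgebra.Build K R^c converse_scalerAr.

End ConverseAlgebra.

(** Generation as an induction principle, the form in which it is used. *)
Definition generates (K : fieldType) (R : algType K) (G : set R) :=
  forall P : R -> Prop, (forall g, G g -> P g) -> P 1 ->
    (forall (c : K) u, P u -> P (c *: u)) ->
    (forall u v, P u -> P v -> P (u + v)) ->
    (forall u v, P u -> P v -> P (u * v)) -> forall u, P u.

(** A self-dual presentation of the algebra of integro-differential operators,
    with $D = \partial$, $J = \int$ and $H = \partial x$. The commutation rules
    $DH = (H + 1)D$ and $HJ = J(H + 1)$ follow from it, and $JD \ne 1$ excludes
    the localization in which [D] is invertible. *)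
Record integro_triple (K : fieldType) (R : algType K) (D J H : R) : Prop := {
  triple_DJ : D * J = 1;
  triple_H : H = J * H * D + 1;
  triple_JD : J * D <> 1;
  triple_gen : generates [set D; J; H] }.

Lemma converse_triple (K : fieldType) (R : algType K) (D J H : R) :
  integro_triple D J H -> @integro_triple K R^c J D H.
Proof.
case=> DJ HE JD gen; split => //; first by rewrite -[LHS]/H {1}HE -mulrA.
move=> P PG P1 PZ PD PM; apply: gen => //; last by move=> u v Pu Pv; apply: (PM v u).
by move=> g [[->|->]|->]; apply: PG; [left; right|left; left|right].
Qed.

(** * Skew polynomials in H and D *)

Section Triple.
Variables (K : fieldType) (R : algType K) (D J H : R).
Hypotheses (charK : [pchar K] =i pred0) (trip : integro_triple D J H).

Let DJ : D * J = 1. Proof. by case: trip. Qed.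
Let HE : H = J * H * D + 1. Proof. by case: trip. Qed.

Let h : {poly K} -> R := horner_alg H.

Let e := 1 - J * D.

Lemma DH : D * H = (H + 1) * D.
Proof. by rewrite {1}HE mulrDr !mulrA DJ mul1r mulr1 mulrDl mul1r. Qed.

Lemma HJ : H * J = J * (H + 1).
Proof. by rewrite {1}HE mulrDl -mulrA DJ mulr1 mul1r mulrDr mulr1. Qed.

Lemma DXJX n : D ^+ n * J ^+ n = 1.
Proof.
elim: n => [|n IH]; first by rewrite !expr0 mulr1.
by rewrite exprSr exprS mulrA -(mulrA _ D) DJ mulr1.
Qed.

Lemma DXJX_geq i n : (i <= n)%N -> D ^+ i * J ^+ n = J ^+ (n - i).
Proof. by move=> le; rewrite -{1}(subnKC le) exprD mulrA DXJX mul1r. Qed.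

Lemma DXJX_leq i n : (n <= i)%N -> D ^+ i * J ^+ n = D ^+ (i - n).
Proof. by move=> le; rewrite -{1}(subnK le) exprD -mulrA DXJX mulr1. Qed.

(** The automorphism $p(X) \mapsto p(X + n)$ by which $D^n$ commutes with
    polynomials in [H]. *)
Definition shift n : {poly K} -> {poly K} := comp_poly ('X + n%:R%:P).
HB.instance Definition _ n := GRing.RMorphism.copy (shift n) (comp_poly ('X + n%:R%:P)).

Lemma hD p q : h (p + q) = h p + h q. Proof. by rewrite /h rmorphD. Qed.
Lemma hM p q : h (p * q) = h p * h q. Proof. by rewrite /h rmorphM. Qed.
Lemma hC c : h c%:P = c%:A. Proof. by rewrite /h horner_algC. Qed.

Lemma hMXaddC p c : h (p * 'X + c%:P) = h p * H + c%:A.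
Proof. by rewrite hD hM hC /h horner_algX. Qed.

Lemma shiftMXaddC n p c :
  shift n (p * 'X + c%:P) = shift n p * ('X + n%:R%:P) + c%:P.
Proof. by rewrite /shift comp_polyD comp_polyM comp_polyX comp_polyC. Qed.

Lemma h_XaddC n : h ('X + n%:R%:P) = H + n%:R.
Proof.
by rewrite hD hC /h horner_algX scaler_nat.
Qed.

Lemma DX_H n : D ^+ n * H = (H + n%:R) * D ^+ n.
Proof.
elim: n => [|n IH]; first by rewrite expr0 mul1r mulr1 addr0.
rewrite exprS -mulrA IH mulrA mulrDr DH mulr_natr -mulr_natl -mulrDl.
by rewrite -addrA nat1r mulrA.
Qed.

Lemma H_JX n : H * J ^+ n = J ^+ n * (H + n%:R).
Proof.
elim: n => [|n IH]; first by rewrite expr0 mul1r mulr1 addr0.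
rewrite exprSr mulrA IH -mulrA mulrDl HJ mulr_natl -mulr_natr -mulrDr.
by rewrite -addrA nat1r mulrA.
Qed.

Lemma DX_h n p : D ^+ n * h p = h (shift n p) * D ^+ n.
Proof.
elim/poly_ind: p => [|p c IH]; first by rewrite /h !rmorph0 mulr0 mul0r.
rewrite shiftMXaddC hMXaddC hD hM h_XaddC hC.
rewrite mulrDr mulrA IH -mulrA DX_H mulrA mulrDl.
by rewrite -scalerAl -scalerAr mulr1 mul1r.
Qed.

Lemma h_JX n p : h p * J ^+ n = J ^+ n * h (shift n p).
Proof.
elim/poly_ind: p => [|p c IH]; first by rewrite /h !rmorph0 mulr0 mul0r.
rewrite shiftMXaddC hMXaddC hD hM h_XaddC hC.
rewrite mulrDl -mulrA H_JX mulrA IH -mulrA [RHS]mulrDr.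
by rewrite -scalerAl -scalerAr mulr1 mul1r.
Qed.

(** The value at $P = \sum_j p_j T^j$ is $\sum_j p_j(H) D^j$: coefficients are
    written on the left of the powers of [D]. *)
Definition skew_eval (P : {poly {poly K}}) : R := (map_poly h P).[D].

Local Notation ev := skew_eval.

Lemma ev0 : ev 0 = 0. Proof. by rewrite /ev /h rmorph0 horner0. Qed.

Lemma evD P Q : ev (P + Q) = ev P + ev Q.
Proof. by rewrite /ev /h rmorphD hornerD. Qed.

Lemma evCM p Q : ev (p%:P * Q) = h p * ev Q.
Proof. by rewrite /ev /h rmorphM /= map_polyC hornerCM. Qed.

Lemma evC p : ev p%:P = h p.
Proof. by rewrite /ev /h map_polyC hornerC. Qed.

Lemma evMXn Q n : ev (Q * 'X^n) = ev Q * D ^+ n.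
Proof.
elim: n => [|n IH]; first by rewrite !expr0 !mulr1.
by rewrite !exprSr !mulrA -IH /ev /h rmorphM /= map_polyX hornerMX.
Qed.

Lemma evXn n : ev 'X^n = D ^+ n.
Proof. by rewrite -[X in ev X]mul1r evMXn evC /h rmorph1 mul1r. Qed.

Lemma evX : ev 'X = D. Proof. exact: (evXn 1). Qed.

Lemma ev1 : ev 1 = 1. Proof. exact: (evXn 0). Qed.

Lemma ev_wide n (P : {poly {poly K}}) : (size P <= n)%N -> ev P = \sum_(j < n) h P`_j * D ^+ j.
Proof.
move=> le; rewrite /ev (horner_coef_wide _ (leq_trans (size_poly _ _) le)).
by apply: eq_bigr => j _; rewrite /h coef_map.
Qed.

Lemma ev_sum (I : Type) (r : seq I) (F : I -> {poly {poly K}}) :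
  ev (\sum_(i <- r) F i) = \sum_(i <- r) ev (F i).
Proof. exact: (big_morph ev evD ev0). Qed.

Lemma DX_ev n P : D ^+ n * ev P = ev (map_poly (shift n) P) * D ^+ n.
Proof.
elim/poly_ind: P => [|P c IH]; first by rewrite rmorph0 ev0 mulr0 mul0r.
rewrite rmorphD rmorphM /= map_polyX map_polyC !evD -['X]expr1 !evMXn !evC.
by rewrite mulrDr mulrA IH mulrDl DX_h -!mulrA -!exprD addnC.
Qed.

(** The product of the skew polynomial ring with $T p = p(X + 1) T$. *)
Definition skew_mul (P Q : {poly {poly K}}) : {poly {poly K}} :=
  \sum_(i < size P) (P`_i)%:P * (map_poly (shift i) Q * 'X^i).

Lemma ev_skew_mul P Q : ev (skew_mul P Q) = ev P * ev Q.
Proof.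
rewrite ev_sum (ev_wide (leqnn _)) mulr_suml; apply: eq_bigr => i _.
by rewrite evCM evMXn -DX_ev mulrA.
Qed.

Lemma coef_skew_mul P Q k : (skew_mul P Q)`_k =
  \sum_(i < size P) P`_i * (if (k < i)%N then 0 else shift i (Q`_(k - i))).
Proof.
rewrite coef_sum; apply: eq_bigr => i _.
by rewrite coefCM coefMXn; case: ifP => //; rewrite coef_map.
Qed.

Lemma size_shift n (p : {poly K}) : size (shift n p) = size p.
Proof. by rewrite size_comp_poly2 // size_XaddC. Qed.

Lemma shift_eq0 n p : (shift n p == 0) = (p == 0).
Proof. by rewrite -!size_poly_eq0 size_shift. Qed.

Lemma skew_mul_neq0 P Q : P != 0 -> Q != 0 -> skew_mul P Q != 0.
Proof.
move=> P0 Q0; apply/eqP => /(congr1 (fun S : {poly {poly K}} =>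
  S`_((size P).-1 + (size Q).-1))) /eqP.
have ltP : ((size P).-1 < size P)%N by rewrite prednK // size_poly_gt0.
rewrite coef0 coef_skew_mul (bigD1 (Ordinal ltP)) //= big1 => [|i].
  rewrite addr0 ltnNge leq_addr /= addKn -!lead_coefE.
  by apply/negP; rewrite mulf_neq0 ?shift_eq0 ?lead_coef_eq0.
rewrite -val_eqE /= => ne; have lti : (i < (size P).-1)%N.
  by rewrite ltn_neqAle ne -ltnS (ltn_predK ltP) ltn_ord.
case: ifP => _; first by rewrite mulr0.
rewrite [Q`_ _]nth_default ?rmorph0 ?mulr0 //.
rewrite -(leq_add2l i) subnKC; last by rewrite (leq_trans (ltnW lti)) ?leq_addr.
by rewrite (leq_trans (leq_add (leqnn i) (leqSpred _))) // addnS ltn_add2r.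
Qed.

(** * Leading coefficients *)

Lemma eJ : e * J = 0.
Proof. by rewrite /e mulrBl mul1r -mulrA DJ mulr1 subrr. Qed.

(** Right multiplication by [J] kills only what lives in the column indexed by 0,
    where [H] takes the value 1. *)
Lemma mul_h_of_mulJ_eq0 y p : y * J = 0 -> y * h p = p.[1] *: y.
Proof.
move=> yJ; have yH : y * H = y by rewrite HE mulrDr !mulrA yJ !mul0r add0r mulr1.
elim/poly_ind: p => [|p c IH]; first by rewrite /h rmorph0 horner0 mulr0 scale0r.
rewrite hMXaddC mulrDr mulrA IH -scalerAl yH hornerMXaddC mulr1 scalerDl.
by rewrite -scalerAr mulr1.
Qed.

(** Multiplying by the power of [J] on the right kills all the terms of lower
    degree, because they leave a factor [x * J ^+ M * J]. The leading term leaves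
    [x * J ^+ M], on which [H], after the shift by $N + M$, takes the value
    $N + M + 1$. *)
Lemma leading_term x N M (P : {poly {poly K}}) : x * J ^+ M * J = 0 ->
  x * D ^+ N * ev P * J ^+ ((size P).-1 + (N + M)) =
    (lead_coef P).[(N + M).+1%:R] *: (x * J ^+ M).
Proof.
move=> yJ; set n := (size P).-1.
rewrite (ev_wide (leqSpred _)) -/n mulr_sumr mulr_suml (bigD1 ord_max) //=.
have term j : (j <= n)%N ->
    x * D ^+ N * (h P`_j * D ^+ j) * J ^+ (n + (N + M)) =
    x * J ^+ M * J ^+ (n - j) * h (shift (n - j + (N + M)) P`_j).
  move=> lejn; rewrite -!mulrA DXJX_geq; last by rewrite (leq_trans lejn) ?leq_addr.
  rewrite -addnBAC // h_JX; congr (_ * _); rewrite !mulrA; congr (_ * _).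
  rewrite -exprD DXJX_geq; last by rewrite addnCA leq_addr.
  by congr (_ ^+ _); lia.
rewrite term // subnn mulr1 add0n mul_h_of_mulJ_eq0 // big1 ?addr0.
  by rewrite /shift horner_comp hornerD hornerX hornerC nat1r.
move=> i; rewrite -val_eqE /= => ni; have lti : (i < n)%N.
  by rewrite ltn_neqAle ni -ltnS ltn_ord.
by rewrite term ?(ltnW lti) // -(subnSK lti) exprS [X in X * h _]mulrA yJ !mul0r.
Qed.

(** Apply [leading_term] to $x = 1 - JD$: the leading coefficient would vanish at
    all large integers. *)
Lemma ev_eq0 P : ev P = 0 -> P = 0.
Proof.
move=> evP; apply/eqP/negPn/negP => P0.
have [|N hN] := nat_root_bound (p := lead_coef P) charK; first by rewrite lead_coef_eq0.
have := @leading_term e N 0 P; rewrite expr0 mulr1 => /(_ eJ) /esym /eqP.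
rewrite evP mulr0 mul0r addn0 scaler_eq0 (negbTE (hN _ _)) //= subr_eq0 eq_sym.
by case: trip => _ _ ne _ /eqP.
Qed.

Lemma ev_mul_eq0 P Q : ev P * ev Q = 0 -> P = 0 \/ Q = 0.
Proof.
rewrite -ev_skew_mul => /ev_eq0 /eqP PQ0.
have [->|P0] := eqVneq P 0; [by left | right; apply/eqP].
by apply: contraLR PQ0; apply: skew_mul_neq0.
Qed.

(** * Reduction to polynomials in H and D *)

(** This is clear for [D], [H] and, as $DJ = 1$, for [J]. For a product $vw$ with
    $D^N v$ in [W], moving $D^M$ across $D^N v$ by [DX_ev] brings it next
    to [w]. *)
Lemma skew_eval_cofinal u : exists N P, D ^+ N * u = ev P.
Proof.
have EX : h 'X = H by rewrite /h horner_algX.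
have lift k N v P : D ^+ N * v = ev P -> exists Q, D ^+ (k + N) * v = ev Q.
  by move=> e1; exists (skew_mul 'X^k P); rewrite exprD -mulrA e1 ev_skew_mul evXn.
case: trip => _ _ _ gen; apply: (gen (fun u => exists N P, D ^+ N * u = ev P)).
- move=> g [[->|->]|->].
  + by exists 0, 'X; rewrite mul1r evX.
  + by exists 1, 1; rewrite expr1 DJ ev1.
  + by exists 0, 'X%:P; rewrite mul1r evC EX.
- by exists 0, 1; rewrite mul1r ev1.
- move=> c v [N [P e1]]; exists N, ((c%:P)%:P * P).
  by rewrite evCM hC -scalerAr e1 mulr_algl.
- move=> v w [N [P e1]] [M [Q e2]].
  have [P' e3] := lift M _ _ _ e1; have [Q' e4] := lift N _ _ _ e2.
  by exists (M + N)%N, (P' + Q'); rewrite mulrDr e3 addnC e4 evD.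
- move=> v w [N [P e1]] [M [Q e2]].
  exists (M + N)%N, (skew_mul (map_poly (shift M) P) Q).
  by rewrite ev_skew_mul -e2 [RHS]mulrA -DX_ev exprD mulrA -(mulrA _ _ v) e1.
Qed.

Lemma skew_eval_cofinal2 u v : exists N P Q, D ^+ N * u = ev P /\ D ^+ N * v = ev Q.
Proof.
have [N [P e1]] := skew_eval_cofinal u; have [M [Q e2]] := skew_eval_cofinal v.
exists (M + N)%N, (skew_mul 'X^M P), (skew_mul 'X^N Q).
by rewrite !ev_skew_mul !evXn -e1 -e2 !mulrA -!exprD addnC.
Qed.

Definition torsion u := exists N, D ^+ N * u = 0.

(** Multiplication by [D] is injective on [W], so a single power of [D] that sends
    [u] into [W] decides whether [u] is torsion. *)
Lemma torsionP u : torsion u <-> forall N P, D ^+ N * u = ev P -> P = 0.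
Proof.
split=> [[M e1] N P e2|h0].
  have [] // := @ev_mul_eq0 'X^M P; last by move/eqP; rewrite -size_poly_eq0 size_polyXn.
  by rewrite evXn -e2 mulrA -exprD addnC exprD -mulrA e1 mulr0.
have [N [P e1]] := skew_eval_cofinal u; exists N.
by rewrite e1 (h0 _ _ e1) ev0.
Qed.

(** Inherited from the absence of zero divisors in [W], through
    $D^{M+N} uv = w' (D^M v)$ with $w' D^M = D^M (D^N u)$. *)
Lemma torsion_prime u v : torsion (u * v) -> torsion u \/ torsion v.
Proof.
have [N [P e1]] := skew_eval_cofinal u; have [M [Q e2]] := skew_eval_cofinal v.
have e3 : D ^+ (M + N) * (u * v) = ev (skew_mul (map_poly (shift M) P) Q).
  by rewrite ev_skew_mul -e2 [RHS]mulrA -DX_ev exprD mulrA -(mulrA _ _ u) e1.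
move/torsionP/(_ _ _ e3) => eq0.
have [P0|Q0] : map_poly (shift M) P = 0 \/ Q = 0.
- by apply: ev_mul_eq0; rewrite -ev_skew_mul eq0 ev0.
- left; exists (M + N)%N; rewrite exprD -mulrA e1.
  by rewrite DX_ev P0 ev0 mul0r.
- by right; exists M; rewrite e2 Q0 ev0.
Qed.

Lemma torsion0 : torsion 0. Proof. by exists 0; rewrite mulr0. Qed.

Lemma D_not_torsion n : ~ torsion (D ^+ n).
Proof.
move/torsionP/(_ 0 'X^n); rewrite mul1r evXn => /(_ erefl) /eqP.
by rewrite -size_poly_eq0 size_polyXn.
Qed.

(** * The torsion ideal is spanned by the matrix units *)

Lemma horner_D_H (p : {poly K}) :
  horner_alg D p * H = H * horner_alg D p + horner_alg D p^`() * D.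
Proof.
elim/poly_ind: p => [|p c IH]; first by rewrite deriv0 !rmorph0 !(mul0r, mulr0) addr0.
rewrite derivD derivM derivX derivC addr0 mulr1 !rmorphD !rmorphM /=.
rewrite horner_algX horner_algC mulrDl -mulrA DH [_ * D]mulrDl mul1r mulrDr mulrA IH.
rewrite [RHS]addrC mulrDl -scalerAl mul1r [H * (_ + _)]mulrDr -scalerAr mulr1.
by rewrite [in RHS]mulrDl !mulrA [RHS]addrCA !addrA.
Qed.

(** The span of the rows $(1 - JD) D^j$ is a right ideal: it is stable under the
    three generators. *)
Lemma torsion_row u (p : {poly K}) : exists q, e * horner_alg D p * u = e * horner_alg D q.
Proof.
case: trip => _ _ _ gen; move: u p.
apply: (gen (fun u => forall p, exists q, e * horner_alg D p * u = e * horner_alg D q)).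
- move=> g [[->|->]|->] p.
  + by exists (p * 'X); rewrite rmorphM /= horner_algX mulrA.
  + elim/poly_ind: p => [|p c _]; first by exists 0; rewrite !rmorph0 mulr0 mul0r.
    exists p; rewrite rmorphD rmorphM /= horner_algX horner_algC.
    by rewrite mulrDr mulrDl -!mulrA DJ mulr1 mulr_algl -scalerAr eJ scaler0 addr0.
  + (* H acts on the rows e p(D) as the Euler operator p |-> (T p)'. *)
    have eH : e * H = e by rewrite HE mulrDr !mulrA eJ !mul0r add0r mulr1.
    exists (p + p^`() * 'X).
    by rewrite -mulrA horner_D_H mulrDr mulrA eH rmorphD rmorphM /= horner_algX mulrDr.
- by move=> p; exists p; rewrite mulr1.
- move=> c u Pu p; have [q e1] := Pu p; exists (c *: q).
  by rewrite -scalerAr e1 linearZ /= mulr_algl -scalerAr.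
- move=> u v Pu Pv p; have [q e1] := Pu p; have [q' e2] := Pv p; exists (q + q').
  by rewrite mulrDr e1 e2 rmorphD mulrDr.
- move=> u v Pu Pv p; have [q e1] := Pu p; have [q' e2] := Pv q; exists q'.
  by rewrite mulrA e1.
Qed.

Definition matrix_unit i j := J ^+ i * D ^+ j - J ^+ i.+1 * D ^+ j.+1.

(** With $e = 1 - JD$ the matrix units are $J^i e D^j$, so left multiples of
    the rows $e D^j$. *)
Lemma matrix_unitE i j : matrix_unit i j = J ^+ i * e * D ^+ j.
Proof. by rewrite /matrix_unit /e mulrBr mulrBl mulr1 exprSr exprS !mulrA. Qed.

Lemma one_matrix_units N : 1 = J ^+ N * D ^+ N + \sum_(i < N) matrix_unit i i.
Proof.
elim: N => [|N IH]; first by rewrite big_ord0 addr0 mulr1.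
by rewrite {1}IH big_ord_recr /= [RHS]addrC -addrA subrK addrC.
Qed.

Lemma DX_matrix_unit N i j : (i < N)%N -> D ^+ N * matrix_unit i j = 0.
Proof.
move=> lt; rewrite /matrix_unit mulrBr !mulrA !DXJX_leq ?(ltnW lt) //.
by rewrite -!exprD -subnSK // addSnnS subrr.
Qed.

Lemma matrix_unit_JX N i j : (j < N)%N -> matrix_unit i j * J ^+ N = 0.
Proof.
move=> lt; rewrite /matrix_unit mulrBl -!mulrA !DXJX_geq ?(ltnW lt) //.
by rewrite -!exprD -(subnSK lt) addnS subrr.
Qed.

(** If $D^N u = 0$ then $u = (1 - J^N D^N) u = \sum_{i < N} J^i e D^i u$ with
    $e = 1 - JD$, and each $e D^i u$ is a combination of rows $e D^j$. *)
Lemma torsion_matrix u : torsion u <->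
  exists (n : nat) (c : 'M[K]_n), u = \sum_(i < n) \sum_(j < n) c i j *: matrix_unit i j.
Proof.
split=> [[N uN]|[n [c ->]]]; last first.
  exists n; rewrite mulr_sumr big1 // => i _; rewrite mulr_sumr big1 // => j _.
  by rewrite -scalerAr DX_matrix_unit ?scaler0.
have /choice [q hq] i : exists q, e * horner_alg D 'X^i * u = e * horner_alg D q.
  exact: torsion_row.
pose m := \max_(i < N) size (q i); pose n := maxn N m.
exists n, (\matrix_(i, j) if (i < N)%N then (q i)`_j else 0).
rewrite -[LHS]mul1r (one_matrix_units N) mulrDl -mulrA uN mulr0 add0r mulr_suml.
rewrite (big_ord_widen n (fun i => matrix_unit i i * u)) ?leq_maxl // big_mkcond.
apply: eq_bigr => i _; case: ifP => iN; last first.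
  by rewrite big1 // => j _; rewrite mxE iN scale0r.
have := hq i; rewrite rmorphXn /= horner_algX => hi.
rewrite matrix_unitE -!mulrA [e * _]mulrA hi.
have le : (size (q i) <= n)%N.
  by rewrite leq_max (leq_bigmax (Ordinal iN)) orbT.
rewrite /horner_alg /horner_morph (horner_coef_wide _ (leq_trans (size_poly _ _) le)).
rewrite !mulr_sumr; apply: eq_bigr => j _.
by rewrite coef_map mxE iN matrix_unitE /= mulr_algl -!scalerAr mulrA.
Qed.

Lemma torsion_mulJX u : torsion u -> exists N, u * J ^+ N = 0.
Proof.
move=> /torsion_matrix [n [c ->]]; exists n.
rewrite mulr_suml big1 // => i _; rewrite mulr_suml big1 // => j _.
by rewrite -scalerAl matrix_unit_JX ?scaler0.
Qed.

(** * Left regular elements *)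

Lemma left_regular_DX n : left_regular R (D ^+ n).
Proof. by move=> x xD; rewrite -[x]mulr1 -(DXJX n) mulrA xD mul0r. Qed.

Lemma left_regular_not_torsion s : left_regular R s -> ~ torsion s.
Proof.
move=> rs [N /rs DN0]; have /eqP := DXJX N.
by rewrite DN0 mul0r eq_sym oner_eq0.
Qed.

(** If [x] kills $D^N P$ from the left, then [x] is torsion, so it is a finite
    matrix. Let [m] be the index of its last nonzero column. By [leading_term]
    that column is multiplied by the value of the leading coefficient at
    $N + m + 1$, which is nonzero once [N] exceeds the natural roots. *)
Lemma left_regular_ev P : P != 0 -> exists N, left_regular R (D ^+ N * ev P).
Proof.
move=> P0; have [|N hN] := nat_root_bound (p := lead_coef P) charK.
  by rewrite lead_coef_eq0.
exists N => x; rewrite mulrA => xt.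
have [M xM] : exists M, x * J ^+ M = 0.
  apply: torsion_mulJX; apply/torsionP => A X e1.
  have [] // := @ev_mul_eq0 X (skew_mul 'X^N P).
    by rewrite -e1 ev_skew_mul evXn -!mulrA [x * _]mulrA xt mulr0.
  move/eqP; rewrite (negbTE (skew_mul_neq0 _ _)) //.
  by rewrite -size_poly_eq0 size_polyXn.
have [[|m] /eqP hm minm] :=
    ex_minnP (ex_intro (fun M => x * J ^+ M == 0) M (introT eqP xM)).
  by rewrite mulr1 in hm.
have := @leading_term x N m P; rewrite -mulrA -exprSr hm => /(_ erefl) /esym /eqP.
rewrite xt mul0r scaler_eq0 (negbTE (hN _ _)) /=; last by rewrite leqW ?leq_addr.
by move/minm; rewrite ltnn.
Qed.

Lemma left_regular_multiple s : ~ torsion s -> exists N, left_regular R (D ^+ N * s).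
Proof.
move=> nts; have [N [P e1]] := skew_eval_cofinal s.
have [|M hM] := @left_regular_ev P.
  by apply: contra_notN nts => /eqP P0; exists N; rewrite e1 P0 ev0.
by exists (M + N)%N; rewrite exprD -mulrA e1.
Qed.

Lemma ass_left_regular : ass_l (left_regular R) = torsion.
Proof.
apply/seteqP; split=> [u [s rs su]|u [N uN]]; last first.
  by exists (D ^+ N) => //; apply: left_regular_DX.
have [||//] := @torsion_prime s u; first by rewrite su; apply: torsion0.
by move/(left_regular_not_torsion rs).
Qed.

(** * The Ore condition by counting dimensions *)

Definition bounded n (P : {poly {poly K}}) :=
  (size P <= n)%N /\ forall j, (size (P`_j)%R <= n)%N.

Lemma bounded_exists P Q : exists n, bounded n P /\ bounded n Q.
Proof.
have bd (S : {poly {poly K}}) : exists n, bounded n S.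
  exists (maxn (size S) (\max_(j < size S) size (S`_j)%R)); split; first exact: leq_maxl.
  move=> j; have [ltj|gej] := ltnP j (size S).
    by rewrite leq_max (leq_bigmax (Ordinal ltj)) orbT.
  by rewrite nth_default // size_poly0.
have [n [nP cP]] := bd P; have [m [mQ cQ]] := bd Q; exists (maxn n m).
by split; split=> [|j]; rewrite leq_max ?nP ?cP ?mQ ?cQ ?orbT.
Qed.

Lemma bounded_skew_mul n m P Q :
  bounded n P -> bounded m Q -> bounded (n + m) (skew_mul P Q).
Proof.
move=> [nP cP] [mQ cQ]; split.
  apply/leq_sizeP => k lek; rewrite coef_skew_mul big1 // => i _.
  case: ifP => _; first by rewrite mulr0.
  rewrite [Q`_ _]nth_default ?rmorph0 ?mulr0 //.
  have lin : (i <= n)%N := ltnW (leq_trans (ltn_ord i) nP).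
  by apply: leq_trans mQ _; lia.
move=> k; rewrite coef_skew_mul; apply: (leq_trans (size_sum _ _ _)).
apply/bigmax_leqP => i _; apply: (leq_trans (size_polyMleq _ _)).
rewrite (leq_trans (leq_pred _)) // leq_add ?cP //.
by case: ifP; rewrite ?size_poly0 ?size_shift.
Qed.

Definition skew_monomial n (k : 'I_n * 'I_n) : {poly {poly K}} := ('X^(k.1))%:P * 'X^(k.2).

Definition skew_comb n (c : 'I_n * 'I_n -> K) : {poly {poly K}} :=
  \sum_k (c k)%:P%:P * skew_monomial k.

Lemma coef_skew_comb n (c : 'I_n * 'I_n -> K) (k : 'I_n * 'I_n) :
  ((skew_comb c)`_k.2)`_k.1 = c k.
Proof.
rewrite !coef_sum (bigD1 k) //= big1 => [|[i j]].
  by rewrite addr0 /skew_monomial mulrA -polyCM coefCM coefXn eqxx mulr1 coefCM coefXn eqxx mulr1.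
case: k => i' j' ne; rewrite /skew_monomial mulrA -polyCM coefCM coefXn /=.
case: eqVneq => [e1|_]; last by rewrite mulr0 coef0.
rewrite mulr1 coefCM coefXn; case: eqVneq => [e2|_]; last by rewrite mulr0.
by case/eqP: ne; congr (_, _); apply: val_inj.
Qed.

Lemma bounded_monomial n (k : 'I_n * 'I_n) : bounded n (skew_monomial k).
Proof.
case: k => i j; split=> [|l]; rewrite /skew_monomial /=.
  by apply/leq_sizeP => l lel; rewrite coefCM coefXn gtn_eqF ?mulr0 // (leq_trans _ lel).
rewrite coefCM coefXn; case: eqP => _; first by rewrite mulr1 size_polyXn.
by rewrite mulr0 size_poly0.
Qed.

Lemma ev_comb n (c : 'I_n * 'I_n -> K) :
  ev (skew_comb c) = \sum_k c k *: ev (skew_monomial k).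
Proof. by rewrite ev_sum; apply: eq_bigr => k _; rewrite evCM hC mulr_algl. Qed.

Lemma bounded_comb n P : bounded n P -> P = skew_comb (fun k : 'I_n * 'I_n => (P`_k.2)`_k.1).
Proof.
have out (S : {poly {poly K}}) i j : bounded n S -> (n <= i)%N || (n <= j)%N -> (S`_j)`_i = 0.
  move=> [nS cS] /orP [le|le]; first by rewrite nth_default // (leq_trans (cS j)).
  by rewrite [S`_j]nth_default ?coef0 // (leq_trans nS).
move=> bP; apply/polyP => j; apply/polyP => i.
have [ij|] := boolP ((n <= i)%N || (n <= j)%N).
  rewrite out // !coef_sum big1 // => k _.
  by rewrite coefCM coefCM (out (skew_monomial k)) ?mulr0 //; apply: bounded_monomial.
rewrite negb_or -!ltnNge => /andP [lti ltj].
by rewrite (coef_skew_comb _ (Ordinal lti, Ordinal ltj)).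
Qed.

(** The polynomials in [H] and [D] of size at most [n] form a space of
    dimension $n^2$. With $n = 3k$ and $k = m + 1$, the images of two copies of it
    lie in a space of dimension $(4k)^2 = 16 k^2 < 18 k^2$, so they satisfy a
    linear relation. *)
Lemma skew_relation m (T : bool -> R -> R) :
  (forall b, linear (T b)) ->
  (forall b n P, bounded n P -> exists Q, bounded (n + m) Q /\ T b (ev P) = ev Q) ->
  exists A B, (A != 0 \/ B != 0) /\ T true (ev A) + T false (ev B) = 0.
Proof.
move=> linT bT; pose n := 3 * m.+1; pose N := 4 * m.+1.
have /choice [Q hQ] (i : bool * ('I_n * 'I_n)) :
    exists Q, bounded N Q /\ T i.1 (ev (skew_monomial i.2)) = ev Q.
  have [Q [[b1 b2] ?]] := bT i.1 n _ (bounded_monomial i.2); exists Q; split => //.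
  by split => [|j]; [apply: leq_trans b1 _ | apply: leq_trans (b2 j) _]; rewrite /n /N; lia.
have [||c [[[b k] ck0] sum0]] := @span_dependent K R _ ('I_N * 'I_N)%type
  (fun i => T i.1 (ev (skew_monomial i.2))) (fun k => ev (skew_monomial k))
  (fun i k => ((Q i)`_k.2)`_k.1).
- by move=> i; have [bQ ->] := hQ i; rewrite {1}(bounded_comb bQ) ev_comb.
- by rewrite !card_prod card_bool !card_ord /n /N; nia.
exists (skew_comb (fun k => c (true, k))), (skew_comb (fun k => c (false, k))); split.
  by case: b ck0 => ck0; [left|right]; apply: contraNneq ck0 => e0;
    rewrite -(coef_skew_comb (fun k => c (_, k)) k) e0 !coef0.
have T0 b' : T b' 0 = 0.
  by have := linT b' (-1) 0 0; rewrite scaler0 addr0 scaleN1r addNr.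
have TE b' : T b' (ev (skew_comb (fun k => c (b', k)))) =
    \sum_k c (b', k) *: T b' (ev (skew_monomial k)).
  rewrite ev_comb; elim/big_rec2: _ => [|l x y _ IH]; first exact: T0.
  by rewrite linT IH.
rewrite !TE -[RHS]sum0.
rewrite (eq_bigr (fun i => c (i.1, i.2) *: T i.1 (ev (skew_monomial i.2)))) => [|[? ?] //].
rewrite -(pair_bigA _ (fun b k => c (b, k) *: T b (ev (skew_monomial k)))) /=.
by rewrite big_bool.
Qed.

Lemma skew_left_ore P Q : Q != 0 ->
  exists A B, A != 0 /\ ev A * ev P = ev B * ev Q.
Proof.
move=> Q0; have [m [bP bQ]] := bounded_exists P Q.
have [b a x y||A [B [AB0 eq0]]] :=
    @skew_relation m (fun b x => x * ev (if b then P else Q)).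
- by rewrite mulrDl scalerAl.
- move=> b n S bS; exists (skew_mul S (if b then P else Q)).
  by rewrite ev_skew_mul; split => //; apply: bounded_skew_mul => //; case: b.
exists A, (- B); move/eqP: (eq0); rewrite addr_eq0 => /eqP e1; split; last first.
  by rewrite e1 -mulNr; congr (_ * _); apply: (addIr (ev B)); rewrite addNr -evD addNr ev0.
case: AB0 => // B0; apply/eqP => A0; move: eq0; rewrite A0 ev0 mul0r add0r.
by case/ev_mul_eq0 => /eqP; rewrite ?(negbTE B0) ?(negbTE Q0).
Qed.

Lemma skew_right_ore P Q : Q != 0 ->
  exists A B, A != 0 /\ ev P * ev A = ev Q * ev B.
Proof.
move=> Q0; have [m [bP bQ]] := bounded_exists P Q.
have [b a x y||A [B [AB0 eq0]]] :=
    @skew_relation m (fun b x => ev (if b then P else Q) * x).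
- by rewrite mulrDr scalerAr.
- move=> b n S bS; exists (skew_mul (if b then P else Q) S).
  by rewrite ev_skew_mul addnC; split => //; apply: bounded_skew_mul => //; case: b.
exists A, (- B); move/eqP: (eq0); rewrite addr_eq0 => /eqP e1; split; last first.
  by rewrite e1 -mulrN; congr (_ * _); apply: (addIr (ev B)); rewrite addNr -evD addNr ev0.
case: AB0 => // B0; apply/eqP => A0; move: eq0; rewrite A0 ev0 mulr0 add0r.
by case/ev_mul_eq0 => /eqP; rewrite ?(negbTE B0) ?(negbTE Q0).
Qed.

(** The relation found in [W] holds exactly, and a further power of [D] turns the
    multiplier of [r] into a left regular element. *)
Lemma left_ore r s : ~ torsion s ->
  exists t a, left_regular R t /\ t * r = a * s.
Proof.
move=> nts; have [N [P [Q [eP eQ]]]] := skew_eval_cofinal2 r s.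
have [|A [B [A0 e1]]] := @skew_left_ore P Q.
  by apply/eqP => Q0; apply: nts; exists N; rewrite eQ Q0 ev0.
have [|M hM] := @left_regular_ev (skew_mul A 'X^N).
  by rewrite skew_mul_neq0 // -size_poly_eq0 size_polyXn.
exists (D ^+ M * ev (skew_mul A 'X^N)), (D ^+ M * ev B * D ^+ N); split => //.
by rewrite ev_skew_mul evXn -!mulrA eP e1 eQ.
Qed.

Lemma left_regular_denominator : left_denominator_set (left_regular R).
Proof.
split.
- split.
  + by move=> x; rewrite mulr1.
  + by move=> s t rs rt x; rewrite mulrA => /rt /rs.
  + by move=> /(_ 1 (mulr0 _)) /eqP; rewrite oner_eq0.
- by move=> r s /left_regular_not_torsion; apply: left_ore.
- by move=> r s rs /rs ->; exists 1; [move=> x; rewrite mulr1 | rewrite mulr0].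
Qed.

End Triple.
(** * Uniqueness of localizations *)

Section LeftLocalization.
Variables (R : nzRingType) (S : set R) (Q : unitRingType) (f : {rmorphism R -> Q}).
Hypothesis locf : left_localization S f.

Let f_unit s : S s -> f s \is a GRing.unit. Proof. by case: locf => H _ _; apply: H. Qed.

Lemma left_localization_frac q : exists s r, S s /\ f s * q = f r.
Proof.
case: locf => _ /(_ q) [s [r [Ss ->]]] _; exists s, r; split=> //.
by rewrite mulVKr ?f_unit.
Qed.

Lemma left_localization_common p q : exists u r r',
  [/\ exists s s', [/\ S s, S s' & u = s * s'], f u * p = f r & f u * q = f r'].
Proof.
have [s [r [Ss e1]]] := left_localization_frac p.
have [s' [r' [Ss' e2]]] := left_localization_frac (f s * q).
exists (s' * s), (s' * r), r'; split; first by exists s', s.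
  by rewrite !rmorphM -mulrA e1.
by rewrite rmorphM -mulrA.
Qed.

Lemma left_localization_ore r s : S s ->
  exists t a, [/\ S t & f (t * r) = f (a * s)].
Proof.
move=> Ss; have [t [a [St e]]] := left_localization_frac (f r * (f s)^-1).
exists t, a; split=> //; rewrite !rmorphM -e !mulrA mulrVK ?f_unit //.
Qed.

End LeftLocalization.

Section Uniqueness.
Variables (R : nzRingType) (S : set R) (Q D : unitRingType).
Variables (f : {rmorphism R -> Q}) (g : {rmorphism R -> D}).
Hypotheses (locf : left_localization S f) (locg : left_localization S g).

Let f_unit s : S s -> f s \is a GRing.unit. Proof. by case: locf => H _ _; apply: H. Qed.
Let g_unit s : S s -> g s \is a GRing.unit. Proof. by case: locg => H _ _; apply: H. Qed.

Lemma localization_same_kernel x y : f x = f y -> g x = g y.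
Proof.
move=> /eqP; rewrite -subr_eq0 -rmorphB => /eqP kf; apply/eqP.
case: locf locg => _ _ ef [_ _ eg].
rewrite -subr_eq0 -rmorphB; apply/eqP.
have : ass_l S (x - y) by rewrite -ef.
by rewrite -eg.
Qed.

(** A characterization of the value [d] at [q] of a morphism $Q \to D$ that carries
    [f] to [g], quantified over all ways to write [q] as a fraction: this makes
    additivity and multiplicativity direct consequences. *)
Definition corresponds q d := forall a b, f a * q = f b -> g a * d = g b.

Lemma corresponds_exists q : exists d, corresponds q d.
Proof.
have [s [r [Ss sq]]] := left_localization_frac locf q.
exists ((g s)^-1 * g r) => a b aq.
have [t [c [St e]]] := left_localization_ore locf a Ss.
have e1 : f (t * b) = f (c * r).
  by rewrite !rmorphM -aq -sq !mulrA -!rmorphM e.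
apply: (mulrI (g_unit St)).
rewrite mulrA -!rmorphM (localization_same_kernel e) (localization_same_kernel e1).
by rewrite !rmorphM mulrA mulrK ?g_unit.
Qed.

Lemma localization_morphism :
  exists phi : {rmorphism Q -> D}, forall q, corresponds q (phi q).
Proof.
have /choice [phi phiP] := corresponds_exists.
have gU s s' : S s -> S s' -> g (s * s') \is a GRing.unit.
  by move=> Ss Ss'; rewrite rmorphM unitrMl ?g_unit.
have phiB : zmod_morphism phi.
  move=> p q.
  have [u [r [r' [[s [s' [Ss Ss' ->]]] e1 e2]]]] := left_localization_common locf p q.
  apply: (mulrI (gU _ _ Ss Ss')); rewrite mulrBr (phiP _ _ _ e1) (phiP _ _ _ e2).
  by rewrite -rmorphB; apply: phiP; rewrite mulrBr e1 e2 rmorphB.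
have phiM : monoid_morphism phi.
  split=> [|p q].
    by rewrite -[phi 1]mul1r -(rmorph1 g); apply: phiP; rewrite mulr1.
  have [s [r [Ss e1]]] := left_localization_frac locf p.
  have [s' [r' [Ss' e2]]] := left_localization_frac locf (f r * q).
  apply: (mulrI (gU _ _ Ss' Ss)).
  rewrite (phiP (p * q) (s' * s) r'); last by rewrite rmorphM -mulrA (mulrA (f s)) e1.
  rewrite rmorphM -[RHS]mulrA [g s * (_ * _)]mulrA (phiP _ _ _ e1) mulrA -rmorphM.
  by apply/esym/phiP; rewrite rmorphM -mulrA.
pose AM := GRing.isZmodMorphism.Build Q D phi phiB.
pose MM := GRing.isMonoidMorphism.Build Q D phi phiM.
pose phiR : {rmorphism Q -> D} := HB.pack phi AM MM.
by exists phiR.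
Qed.

End Uniqueness.

Lemma left_localization_unique (R : nzRingType) (S : set R) (Q D : unitRingType)
    (f : {rmorphism R -> Q}) (g : {rmorphism R -> D}) :
  left_localization S f -> left_localization S g ->
  exists2 phi : {rmorphism Q -> D}, bijective phi & forall x, phi (f x) = g x.
Proof.
move=> lf lg; have [phi hphi] := localization_morphism lf lg.
have [psi hpsi] := localization_morphism lg lf.
have fg x : phi (f x) = g x.
  by rewrite -[LHS]mul1r -(rmorph1 g); apply: hphi; rewrite rmorph1 mul1r.
have gf x : psi (g x) = f x.
  by rewrite -[LHS]mul1r -(rmorph1 f); apply: hpsi; rewrite rmorph1 mul1r.
exists phi => //; exists psi => q.
- have [s [r [Ss e]]] := left_localization_frac lf q.
  have us : f s \is a GRing.unit by case: lf => H _ _; apply: H.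
  by apply: (mulrI us); rewrite e; apply: hpsi; apply: hphi.
- have [s [r [Ss e]]] := left_localization_frac lg q.
  have us : g s \is a GRing.unit by case: lg => H _ _; apply: H.
  by apply: (mulrI us); rewrite e; apply: hphi; apply: hpsi.
Qed.

(** * Localizations of a triple *)

Section TripleLocalization.
Variables (K : fieldType) (R : algType K) (D J H : R).
Hypotheses (charK : [pchar K] =i pred0) (trip : integro_triple D J H).

Let trip' := converse_triple trip.

Local Notation tor := (torsion D).

(** Torsion elements are the finite matrices, a left-right symmetric notion. *)
Lemma torsion_converse u : @torsion K R^c J u <-> torsion D u.
Proof.
split=> [/(torsion_mulJX trip')|/(torsion_mulJX trip)] [N uN]; exists N.
  by rewrite -[RHS]uN -(revrX D).
by rewrite -[RHS]uN -(revrX J).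
Qed.

Lemma ass_right_regular : ass_r (right_regular R) = tor.
Proof.
have := ass_left_regular charK trip'.
rewrite -[LHS]/(ass_r (right_regular R)) => ->.
by apply/seteqP; split=> u /torsion_converse.
Qed.

Lemma right_regular_not_torsion s : right_regular R s -> ~ tor s.
Proof.
by move=> rs /torsion_converse; apply: (left_regular_not_torsion (R := R^c) trip').
Qed.

Lemma right_regular_multiple s : ~ tor s -> exists N, right_regular R (s * J ^+ N).
Proof.
move=> nts; have [|N hN] := left_regular_multiple charK trip' (s := s).
  by move/torsion_converse.
by exists N; rewrite -revrX.
Qed.

Lemma right_ore r s : ~ tor s -> exists t a, right_regular R t /\ r * t = s * a.
Proof.
move=> nts; have [|t [a [rt e]]] := left_ore charK trip' r (s := s).
  by move/torsion_converse.
by exists t, a.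
Qed.

Lemma right_regular_denominator : right_denominator_set (right_regular R).
Proof.
have [[S1 SM S0] ore rev] := left_regular_denominator charK trip'.
by split=> //; split=> // s t Ss St; apply: (SM t s).
Qed.

Section Morphism.
Variables (Q : unitRingType) (f : {rmorphism R -> Q}).

Definition nontorsion : set R := fun u => ~ tor u.

Lemma ass_l_nontorsion : ass_l nontorsion = tor.
Proof.
apply/seteqP; split=> [u [s ns su]|u [N uN]]; last first.
  by exists (D ^+ N) => //; apply: (D_not_torsion charK trip).
by have [||//] := torsion_prime charK trip (u := s) (v := u); first by rewrite su; apply: torsion0.
Qed.

(** For [s] outside the torsion ideal both $D^N$ and some $D^N s$ are left
    regular, hence the image of [s] is invertible as well. *)
Lemma nontorsion_of_left :
  left_localization (left_regular R) f -> left_localization nontorsion f.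
Proof.
case=> fU fF fK; split.
- move=> s /(left_regular_multiple charK trip) [N /fU].
  by rewrite rmorphM unitrMr // fU //; apply: (left_regular_DX trip).
- move=> q; have [s [r [Ss ->]]] := fF q; exists s, r; split=> //.
  exact: (left_regular_not_torsion trip).
- by rewrite fK ass_l_nontorsion (ass_left_regular charK trip).
Qed.

Lemma right_regular_JX n : right_regular R (J ^+ n).
Proof. by move=> x; have := left_regular_DX trip' (n := n) (x := x); rewrite revrX. Qed.

(** Mirror image of the previous argument, except that the right fractions
    $r s^{-1}$ are rewritten as left ones by the left Ore condition. Both
    localizations thus satisfy the same universal property. *)
Lemma nontorsion_of_right :
  right_localization (right_regular R) f -> left_localization nontorsion f.
Proof.
case=> fU fF fK.
have fN s : nontorsion s -> f s \is a GRing.unit.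
  move=> /right_regular_multiple [N /fU].
  by rewrite rmorphM unitrMl // fU //; apply: right_regular_JX.
split=> //; last by rewrite fK ass_l_nontorsion ass_right_regular.
move=> q; have [s [r [Ss ->]]] := fF q.
have ns := right_regular_not_torsion Ss.
have [t [a [rt e]]] := left_ore charK trip r ns.
have nt := left_regular_not_torsion trip rt.
exists t, a; split=> //; apply: (mulrI (fN _ nt)); rewrite mulVKr ?fN //.
by rewrite mulrA -rmorphM e rmorphM mulrK ?fN.
Qed.

Lemma right_of_nontorsion :
  left_localization nontorsion f -> right_localization (right_regular R) f.
Proof.
case=> fU fF fK; split.
- by move=> s /right_regular_not_torsion; apply: fU.
- move=> q; have [s [r [Ss ->]]] := fF q.
  have [t [a [rt e]]] := right_ore r Ss.
  have nt := right_regular_not_torsion rt.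
  exists t, a; split=> //; apply: (mulIr (fU _ nt)); rewrite mulrVK ?fU //.
  by rewrite -mulrA -rmorphM e rmorphM mulKr ?fU.
- by rewrite fK ass_l_nontorsion ass_right_regular.
Qed.

Lemma nontorsion_division : left_localization nontorsion f -> division_ring Q.
Proof.
case=> fU fF fK x; have [s [r [Ss ->]]] := fF x => nz.
rewrite unitrMl ?unitrV ?fU //; move=> tr; move: nz.
have : tor r by [].
by rewrite -ass_l_nontorsion -fK => /= ->; rewrite mulr0 eqxx.
Qed.

End Morphism.
End TripleLocalization.
(** * Integro-differential operators and the Weyl algebra *)

Lemma gen_subalg_generates (K : fieldType) (A : algType K) (G : set A) :
  generates ([set u : gen_subalg G | G (val u)]%classic : set (gen_subalg G)).
Proof.
move=> P PG P1 PZ PD PM u.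
pose S : {pred A} := fun a => `[< exists v : gen_subalg G, val v = a /\ P v >].
have clS : GRing.subalg_closed S.
  split.
  - by apply/asboolP; exists 1.
  - move=> c a b /asboolP [v [<- Pv]] /asboolP [w [<- Pw]]; apply/asboolP.
    by exists (c *: v + w); split; [|apply/PD => //; apply: PZ].
  - move=> a b /asboolP [v [<- Pv]] /asboolP [w [<- Pw]]; apply/asboolP.
    by exists (v * w); split; [|apply: PM].
have GS a : G a -> a \in S.
  by move=> Ga; apply/asboolP; exists (GenSubalg (mem_gen Ga)); split => //; apply: PG.
have /asboolP /(_ S clS GS) /asboolP [v [e Pv]] := valP u.
by rewrite -(val_inj e).
Qed.

Section Operators.
Variable K : fieldType.
Hypothesis charK : [pchar K] =i pred0.

Lemma mulX_I1 : I1_gens (mulX K). Proof. by left; left. Qed.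
Lemma mulX_A1 : ([set mulX K; diff K]%classic : set _) (mulX K). Proof. by left. Qed.
Lemma diff_A1 : ([set mulX K; diff K]%classic : set _) (diff K). Proof. by right. Qed.

Definition I1_X : I1 K := GenSubalg (mem_gen mulX_I1).
Definition A1_X : A1 K := GenSubalg (mem_gen mulX_A1).
Definition A1_diff : A1 K := GenSubalg (mem_gen diff_A1).
Definition I1_H : I1 K := I1_diff K * I1_X.

Lemma diff_integ : diff K * integ K = 1.
Proof.
apply: endoP => p; apply/polyP => i.
rewrite -[LHS]/((integ_fun p)^`()`_i) coef_deriv coef_integ_fun /= -[LHS]mulr_natr divfK //.
by rewrite (proj1 (pcharf0P K) charK).
Qed.

Lemma integ_diff_mulX : integ K * diff K * mulX K = mulX K.
Proof.
apply: endoP => p; apply/polyP => i.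
rewrite -[LHS]/((integ_fun ('X * p)^`())`_i) -[RHS]/(('X * p)`_i) coef_integ_fun.
case: i => [|i]; first by rewrite coefXM.
rewrite coef_deriv -[_ *+ i.+1]mulr_natr mulfK // (proj1 (pcharf0P K) charK) //.
Qed.

Lemma diff_mulX : diff K * mulX K = mulX K * diff K + 1.
Proof.
apply: endoP => p; rewrite -[LHS]/(('X * p)^`()) -[RHS]/('X * p^`() + p).
by rewrite derivM derivX mul1r addrC.
Qed.

Lemma integ_diff_neq1 : integ K * diff K <> 1.
Proof.
move/(congr1 (fun f : endo K => (f 1)`_0)) => /=.
rewrite -[LHS]/((integ_fun (1^`()))`_0) coef_integ_fun -[RHS]/((1 : {poly K})`_0).
by rewrite coef1 => /esym /eqP; rewrite oner_eq0.
Qed.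

Lemma I1_triple : integro_triple (I1_diff K) (I1_integ K) I1_H.
Proof.
have XJH : I1_X = I1_integ K * I1_H.
  by apply: val_inj; rewrite /= mulrA -[LHS]integ_diff_mulX.
split.
- by apply: val_inj; apply: diff_integ.
- by rewrite -XJH; apply: val_inj; apply: diff_mulX.
- by move/(congr1 val); apply: integ_diff_neq1.
- move=> P PG P1 PZ PD PM; apply: gen_subalg_generates => //.
  have PDi : P (I1_diff K) by apply: PG; left; left.
  have PJ : P (I1_integ K) by apply: PG; left; right.
  have PX : P I1_X by rewrite XJH; apply: PM => //; apply: PG; right.
  move=> g [[e|e]|e]; [rewrite (_ : g = I1_X)|rewrite (_ : g = I1_diff K)
    |rewrite (_ : g = I1_integ K)] => //; exact: val_inj.
Qed.

Local Notation tor := (torsion (I1_diff K)).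
Local Notation ev := (skew_eval (I1_diff K) I1_H).

Lemma F_ideal_torsion : F_ideal K = tor.
Proof. by apply/seteqP; split=> u /(torsion_matrix I1_triple). Qed.

Lemma A1_sub_I1 (a : A1 K) : val a \in gen_pred (@I1_gens K).
Proof.
apply/asboolP => S clS GS; have /asboolP := valP a; apply => // g Gg.
by apply: GS; left.
Qed.

Definition A1_to_I1 (a : A1 K) : I1 K := GenSubalg (A1_sub_I1 a).

Lemma A1_to_I1_zmod : zmod_morphism A1_to_I1.
Proof. by move=> a b; apply: val_inj. Qed.
HB.instance Definition _ := GRing.isZmodMorphism.Build (A1 K) (I1 K) A1_to_I1 A1_to_I1_zmod.

Lemma A1_to_I1_monoid : monoid_morphism A1_to_I1.
Proof. by split=> [|a b]; apply: val_inj. Qed.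
HB.instance Definition _ := GRing.isMonoidMorphism.Build (A1 K) (I1 K) A1_to_I1 A1_to_I1_monoid.

Lemma A1_to_I1Z c a : A1_to_I1 (c *: a) = c *: A1_to_I1 a.
Proof. by apply: val_inj. Qed.

Lemma A1_to_I1_inj : injective A1_to_I1.
Proof. by move=> a b /(congr1 val) e; apply: val_inj. Qed.

Lemma A1_to_I1_diff : A1_to_I1 A1_diff = I1_diff K.
Proof. exact: val_inj. Qed.

Lemma A1_to_I1_X : A1_to_I1 A1_X = I1_X.
Proof. exact: val_inj. Qed.

Lemma skew_eval_A1 P : exists a, A1_to_I1 a = ev P.
Proof.
elim/poly_ind: P => [|P p [a e1]]; first by exists 0; rewrite rmorph0 ev0.
have [b e2] : exists b, A1_to_I1 b = horner_alg I1_H p.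
  elim/poly_ind: p => [|p c [b e2]]; first by exists 0; rewrite !rmorph0.
  exists (b * (A1_diff * A1_X) + c *: 1).
  by rewrite hMXaddC rmorphD !rmorphM /= A1_to_I1Z rmorph1 e2 A1_to_I1_diff A1_to_I1_X.
exists (a * A1_diff + b).
by rewrite evD (evMXn _ _ _ 1) evC rmorphD rmorphM /= e1 e2 A1_to_I1_diff.
Qed.

Lemma unshift n (P : {poly {poly K}}) : exists P', map_poly (shift n) P' = P.
Proof.
exists (map_poly (comp_poly ('X - n%:R%:P)) P).
rewrite -map_poly_comp map_poly_id // => p _ /=.
rewrite /shift /= -comp_polyA comp_polyB comp_polyX comp_polyC addrK.
exact: comp_polyXr.
Qed.

(** Right multiplication by powers of [D] also brings elements of $A_1$ into [W];
    this fails in $I_1$, where $\int \partial^N$ is not in [W] for any [N]. *)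
Lemma A1_right_cofinal a : exists N P, A1_to_I1 a * I1_diff K ^+ N = ev P.
Proof.
have lift k N v P : A1_to_I1 v * I1_diff K ^+ N = ev P ->
    exists Q, A1_to_I1 v * I1_diff K ^+ (N + k) = ev Q.
  by move=> e1; exists (P * 'X^k); rewrite evMXn exprD mulrA e1.
have HE : I1_H = I1_X * I1_diff K + 1 by apply: val_inj; apply: diff_mulX.
apply: (gen_subalg_generates (P := fun a => exists N P, A1_to_I1 a * I1_diff K ^+ N = ev P)).
- move=> g [e|e].
  + exists 1%N, ('X - 1)%:P; rewrite evC rmorphB /= horner_algX rmorph1 HE addrK expr1.
    by congr (_ * _); apply: val_inj.
  + exists 0%N, 'X; rewrite mulr1 evX; exact: val_inj.
- by exists 0%N, 1; rewrite rmorph1 mul1r ev1.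
- move=> c v [N [P e1]]; exists N, ((c%:P)%:P * P).
  by rewrite evCM hC A1_to_I1Z -scalerAl e1 mulr_algl.
- move=> v w [N [P e1]] [M [Q e2]].
  have [P' e3] := lift M _ _ _ e1; have [Q' e4] := lift N _ _ _ e2.
  by exists (N + M)%N, (P' + Q'); rewrite rmorphD /= mulrDl e3 addnC e4 evD.
- move=> v w [N [P e1]] [M [Q e2]]; have [Q' eQ] := unshift N Q.
  exists (M + N)%N, (skew_mul P Q').
  rewrite (ev_skew_mul I1_triple) -e1 -mulrA (DX_ev I1_triple) eQ rmorphM /= exprD.
  by rewrite -!mulrA [A1_to_I1 w * _]mulrA e2.
Qed.

(** Right multiplication by $D^N$ is injective and sends [a] into [W], which has no
    torsion. *)
Lemma A1_torsion (a : A1 K) : tor (A1_to_I1 a) -> a = 0.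
Proof.
have [N [P e1]] := A1_right_cofinal a => -[M aM]; apply: A1_to_I1_inj; rewrite rmorph0.
have P0 : P = 0.
  have [||//] := @ev_mul_eq0 _ _ _ _ _ charK I1_triple 'X^M P.
    by rewrite evXn -e1 mulrA aM mul0r.
  by move/eqP; rewrite -size_poly_eq0 size_polyXn.
by rewrite -[LHS]mulr1 -(DXJX I1_triple N) mulrA e1 P0 ev0 mul0r.
Qed.

Lemma torsion_A1_0 : tor (A1_to_I1 (0 : A1 K)). Proof. by rewrite rmorph0; apply: torsion0. Qed.

Lemma A1_mul_eq0 (a b : A1 K) : a * b = 0 -> a = 0 \/ b = 0.
Proof.
move=> ab0; have tab : tor (A1_to_I1 a * A1_to_I1 b).
  by rewrite -rmorphM ab0; apply: torsion_A1_0.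
by have [/A1_torsion|/A1_torsion] := torsion_prime charK I1_triple tab; [left|right].
Qed.

Lemma A1_regularP (s : A1 K) : regular_elements (A1 K) s <-> s <> 0.
Proof.
split=> [[rs _] s0|s0].
  have /rs /eqP : 1 * s = 0 by rewrite s0 mulr0.
  by rewrite oner_eq0.
by split=> x /A1_mul_eq0 [].
Qed.

Lemma A1_right_ore (r s : A1 K) : s <> 0 -> exists t a, t <> 0 /\ r * t = s * a.
Proof.
move=> s0; have [N [P eP]] := A1_right_cofinal r; have [M [Q eQ]] := A1_right_cofinal s.
have [|A [B [A0 e1]]] := skew_right_ore charK I1_triple P (Q := Q).
  apply/eqP => Q0; apply: s0; apply: A1_to_I1_inj.
  by rewrite -[LHS]mulr1 -(DXJX I1_triple M) mulrA eQ Q0 ev0 mul0r rmorph0.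
have [a ea] := skew_eval_A1 A; have [b eb] := skew_eval_A1 B.
exists (A1_diff ^+ N * a), (A1_diff ^+ M * b); split.
  case/A1_mul_eq0 => [DN0|a0].
    apply: (D_not_torsion charK I1_triple (n := N)); exists 0%N.
    by rewrite mul1r -A1_to_I1_diff -rmorphXn DN0 rmorph0.
  move: A0; rewrite (ev_eq0 charK I1_triple (P := A)) ?eqxx //.
  by rewrite -ea a0 rmorph0.
apply: A1_to_I1_inj; rewrite !rmorphM !rmorphXn /= A1_to_I1_diff ea eb !mulrA.
by rewrite eP eQ.
Qed.

Lemma ass_regular_A1 : ass_l (regular_elements (A1 K)) = [set 0]%classic /\
  ass_r (regular_elements (A1 K)) = [set 0]%classic.
Proof.
have reg1 : regular_elements (A1 K) 1 by apply/A1_regularP/eqP; rewrite oner_eq0.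
split; apply/seteqP; split=> a.
- by move=> [s [_ rr] /rr].
- by move=> ->; exists 1; rewrite ?mulr0.
- by move=> [s [rl _] /rl].
- by move=> ->; exists 1; rewrite ?mul0r.
Qed.

Section Morphism.
Variables (Q : unitRingType) (f : {rmorphism I1 K -> Q}).

Lemma A1_left_localization :
  left_localization (nontorsion (I1_diff K)) f ->
  left_localization (regular_elements (A1 K)) (f \o A1_to_I1).
Proof.
move=> [fU fF fK]; split.
- by move=> s /A1_regularP s0; apply: fU => /A1_torsion.
- move=> q; have [s [r [ns ->]]] := fF q.
  have [N [P [S [eP eS]]]] := skew_eval_cofinal2 I1_triple r s.
  have [a ea] := skew_eval_A1 P; have [b eb] := skew_eval_A1 S.
  have uD : f (I1_diff K ^+ N) \is a GRing.unit.
    by apply: fU; apply: (D_not_torsion charK I1_triple).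
  exists b, a; split.
    by apply/A1_regularP => b0; apply: ns; exists N; rewrite eS -eb b0 rmorph0.
  by rewrite /= ea eb -eP -eS !rmorphM invrM ?uD ?(fU _ ns) // -mulrA mulKr.
- rewrite (proj1 ass_regular_A1); apply/seteqP; split=> a /=; last by move=> ->; rewrite !rmorph0.
  have e1 := ass_l_nontorsion charK I1_triple; rewrite -fK in e1.
  move=> fa0; apply: A1_torsion; rewrite -e1; exact: fa0.
Qed.

Lemma A1_classical_quotient_ring :
  left_localization (nontorsion (I1_diff K)) f ->
  classical_quotient_ring (f \o A1_to_I1).
Proof.
move=> /A1_left_localization lf; split=> //; case: (lf) => fU fF fK; split=> //.
- move=> q; have [s [r [rs ->]]] := fF q.
  have [t [a [t0 e1]]] := A1_right_ore r (proj1 (A1_regularP s) rs).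
  have rt : regular_elements (A1 K) t by apply/A1_regularP.
  exists t, a; split=> //; apply: (mulIr (fU _ rt)); rewrite mulrVK ?fU //.
  by rewrite -mulrA -rmorphM e1 rmorphM mulKr ?fU.
- by rewrite fK (proj1 ass_regular_A1) (proj2 ass_regular_A1).
Qed.

(** All localizations in play invert exactly the operators outside [F], and any
    such operator becomes a differential operator after left multiplication by
    a power of $\partial$; so they are all the quotient ring of $A_1$. *)
Lemma localization_quotient_ring :
  left_localization (nontorsion (I1_diff K)) f ->
  division_ring Q /\
  forall (D : unitRingType) (g : {rmorphism A1 K -> D}),
    classical_quotient_ring g -> isomorphic_over f g.
Proof.
move=> lf; split; first exact: (nontorsion_division charK I1_triple lf).
move=> D g [lg _].
have [phi phib phiE] := left_localization_unique (A1_left_localization lf) lg.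
exists phi => // c; rewrite -phiE /= A1_to_I1Z.
by congr (phi (f _)); congr (_ *: _); apply: val_inj.
Qed.

End Morphism.
End Operators.

Theorem theorem6p5 (K : fieldType) (charK : [pchar K] =i pred0) :
  [/\ exists (D : unitRingType) (g : {rmorphism A1 K -> D}),
        classical_quotient_ring g,
      [/\ left_denominator_set (left_regular (I1 K)),
          exists (Q : unitRingType) (f : {rmorphism I1 K -> Q}),
            left_localization (left_regular (I1 K)) f,
          forall (Q : unitRingType) (f : {rmorphism I1 K -> Q}),
            left_localization (left_regular (I1 K)) f ->
            division_ring Q /\
            forall (D : unitRingType) (g : {rmorphism A1 K -> D}),
              classical_quotient_ring g -> isomorphic_over f g &
          ass_l (left_regular (I1 K)) = F_ideal K] &
      [/\ right_denominator_set (right_regular (I1 K)),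
          exists (Q : unitRingType) (f : {rmorphism I1 K -> Q}),
            right_localization (right_regular (I1 K)) f,
          forall (Q : unitRingType) (f : {rmorphism I1 K -> Q}),
            right_localization (right_regular (I1 K)) f ->
            division_ring Q /\
            forall (D : unitRingType) (g : {rmorphism A1 K -> D}),
              classical_quotient_ring g -> isomorphic_over f g &
          ass_r (right_regular (I1 K)) = F_ideal K]].
Proof.
have trip := I1_triple charK.
have denL := left_regular_denominator charK trip.
have [Q [f lf]] := left_localization_exists denL.
have nf := nontorsion_of_left charK trip lf.
split.
- by exists Q; eexists; apply: A1_classical_quotient_ring nf.
- split=> //; first by exists Q, f.
    move=> Q' f' /(nontorsion_of_left charK trip); exact: localization_quotient_ring.
  by rewrite (ass_left_regular charK trip) F_ideal_torsion.
- split; first exact: (right_regular_denominator charK trip).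
  + by exists Q, f; apply: (right_of_nontorsion charK trip).
  + move=> Q' f' /(nontorsion_of_right charK trip); exact: localization_quotient_ring.
  + by rewrite (ass_right_regular charK trip) F_ideal_torsion.
Qed.
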